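(* There exist a sequence $\{f_n\}_{n\ge0}$ of functions in $B_{\infty,1}^1(\mathbb R^2)$ and sequences of self-adjoint finite rank operators $\{A_1^{(n)}\}_{n\ge0}$, $\{A_2^{(n)}\}_{n\ge0}$ and $\{B^{(n)}\}_{n\ge0}$ such that the norms $\|f_n\|_{B_{\infty,1}^1}$ do not depend on $n$, $$\lim_{n\to\infty}\big\|A_1^{(n)}-A_2^{(n)}\big\|=0,\quad\text{but}\quad \lim_{n\to\infty}\big\|f_n\big(A_1^{(n)},B^{(n)}\big)-f_n\big(A_2^{(n)},B^{(n)}\big)\big\|=\infty.$$ The same is true with the operator norm replaced by the norm of $\boldsymbol S_p$, for every $p>2$.
   Context: $\boldsymbol S_p$ is the Schatten--von Neumann class. For finite rank self-adjoint $A,B$ (not assumed to commute) with spectral measures $E_A,E_B$, $f(A,B)=\iint f\,dE_A\,dE_B=\sum_{\lambda\in\sigma(A),\,\mu\in\sigma(B)}f(\lambda,\mu)\,E_A(\{\lambda\})E_B(\{\mu\})$. Besov class: fix an infinitely differentiable $w\ge0$ on $\mathbb R$ with $\operatorname{supp}w\subset[1/2,2]$ and $w(s)=1-w(s/2)$ for $s\in[1,2]$. Define $W_n$, $n\in\mathbb Z$, on $\mathbb R^2$ by $(\mathscr FW_n)(x)=w(\|x\|_2/2^n)$ ($\mathscr F$ the Fourier transform). $B_{\infty,1}^1(\mathbb R^2)$ is the space of tempered distributions $f$ with $\|f\|_{B_{\infty,1}^1}:=\sum_{n\in\mathbb Z}2^n\|f*W_n\|_{L^\infty}<\infty$ and $\partial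 f/\partial x_i=\sum_n\partial(f*W_n)/\partial x_i$ in $\mathscr S'(\mathbb R^2)$ for $i=1,2$. Such $f$ are continuously differentiable functions, determined by $\{f*W_n\}$ up to an additive constant. *)

(* Defs.v *)
From HB Require Import structures.
From mathcomp Require Import all_boot all_order all_algebra.
From mathcomp Require Import all_classical all_reals all_analysis.
From mathcomp Require Import sesquilinear complex.

Set Implicit Arguments.
Unset Strict Implicit.
Unset Printing Implicit Defensive.

Import Order.TTheory GRing.Theory Num.Theory.
Import numFieldNormedType.Exports.

Local Open Scope classical_set_scope.
Local Open Scope complex_scope.
Local Open Scope ring_scope.

(** [R[i]] carries no topology in the library, so limits, derivatives and
    integrals of complex quantities are taken on real and imaginary parts. *)

Notation cabs := ComplexField.Normc.normc.

Definition norm2 (R : realType) (x : R * R) : R :=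
  Num.sqrt (x.1 ^+ 2 + x.2 ^+ 2).

Definition cis (R : realType) (t : R) : R[i] := cos t +i* sin t.

Definition ccvg (R : realType) (u : nat -> R[i]) (l : R[i]) : Prop :=
  ((fun n => complex.Re (u n)) @ \oo --> complex.Re l) /\
  ((fun n => complex.Im (u n)) @ \oo --> complex.Im l).

(** Two-sided series: both one-sided halves converge ([Negz k] is [- k.+1]). *)
Definition csumZ (R : realType) (a : int -> R[i]) (S : R[i]) : Prop :=
  exists Sp Sm : R[i],
    [/\ ccvg (fun N => \sum_(0 <= k < N) a (Posz k)) Sp,
        ccvg (fun N => \sum_(0 <= k < N) a (Negz k)) Sm &
        S = Sp + Sm].

Definition leb2 (R : realType) :
    {measure set (measurableTypeR R * measurableTypeR R) -> \bar R} :=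
  (@lebesgue_measure R \x @lebesgue_measure R)%E.
Arguments leb2 : clear implicits.

Definition cintegrable (R : realType) (g : R * R -> R[i]) : Prop :=
  (leb2 R).-integrable setT (EFin \o (fun x => complex.Re (g x))) /\
  (leb2 R).-integrable setT (EFin \o (fun x => complex.Im (g x))).

Definition cintegral (R : realType) (g : R * R -> R[i]) : R[i] :=
  Rintegral (leb2 R) setT (fun x => complex.Re (g x)) +i*
  Rintegral (leb2 R) setT (fun x => complex.Im (g x)).

Definition ccontinuous (R : realType) (g : R * R -> R[i]) : Prop :=
  continuous (fun x => complex.Re (g x)) /\
  continuous (fun x => complex.Im (g x)).

Definition dir (R : realType) (b : bool) : R * R :=
  if b then (0, 1) else (1, 0).

Definition has_partials (R : realType) (g : R * R -> R[i]) : Prop :=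
  forall (b : bool) (x : R * R),
    derivable (fun y => complex.Re (g y)) x (dir R b) /\
    derivable (fun y => complex.Im (g y)) x (dir R b).

Definition partial (R : realType) (b : bool) (g : R * R -> R[i])
    (x : R * R) : R[i] :=
  'D_(dir R b) (fun y => complex.Re (g y)) x +i*
  'D_(dir R b) (fun y => complex.Im (g y)) x.

Definition partials (R : realType) (s : seq bool) (g : R * R -> R[i]) :
    R * R -> R[i] :=
  foldr (@partial R) g s.

Definition C1 (R : realType) (g : R * R -> R[i]) : Prop :=
  has_partials g /\ forall b : bool, ccontinuous (partial b g).

Definition smooth (R : realType) (g : R * R -> R[i]) : Prop :=
  forall s : seq bool,
    has_partials (partials s g) /\ ccontinuous (partials s g).

Definition schwartz_norm (R : realType) (N : nat) (phi : R * R -> R[i]) :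
    \bar R :=
  ereal_sup [set y | exists (s : seq bool) (x : R * R), (size s <= N)%N /\
    y = ((1 + norm2 x) ^+ N * cabs (partials s phi x))%:E].

Definition schwartz (R : realType) (phi : R * R -> R[i]) : Prop :=
  smooth phi /\ forall N : nat, (schwartz_norm N phi < +oo)%E.

(** A distribution is a functional on all functions of which only the values
    on Schwartz functions matter. *)
Definition tempered (R : realType) (T : (R * R -> R[i]) -> R[i]) : Prop :=
  (forall (a : R[i]) (phi psi : R * R -> R[i]), schwartz phi -> schwartz psi ->
     T (fun x => a * phi x + psi x) = a * T phi + T psi) /\
  (exists (N : nat) (c : R), forall phi : R * R -> R[i], schwartz phi ->
     ((cabs (T phi))%:E <= c%:E * schwartz_norm N phi)%E).

Definition distr_of (R : realType) (g : R * R -> R[i]) (phi : R * R -> R[i]) :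
    R[i] :=
  cintegral (fun x => g x * phi x).

Definition distr_partial (R : realType) (b : bool)
    (T : (R * R -> R[i]) -> R[i]) (phi : R * R -> R[i]) : R[i] :=
  - T (partial b phi).

Definition distr_conv (R : realType) (T : (R * R -> R[i]) -> R[i])
    (psi : R * R -> R[i]) (x : R * R) : R[i] :=
  T (fun y => psi (x - y)).

(** Normalised as [(F phi)(xi) = \int phi(x) e^(- i <x, xi>) dx]. *)
Definition fourier (R : realType) (phi : R * R -> R[i]) (xi : R * R) : R[i] :=
  cintegral (fun x => phi x * cis (- (x.1 * xi.1 + x.2 * xi.2))).

Definition besov_window (R : realType) (w : R -> R) : Prop :=
  [/\ forall (k : nat) (s : R), derivable (derive1n k w) s 1,
      forall s : R, 0 <= w s,
      closure [set s | w s != 0] `<=` [set s | 2^-1 <= s <= 2] &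
      forall s : R, 1 <= s <= 2 -> w s = 1 - w (s / 2)].

(** The Fourier transform is a bijection of the Schwartz space, so that this
    determines [W] from [w]. *)
Definition besov_kernels (R : realType) (w : R -> R)
    (W : int -> R * R -> R[i]) : Prop :=
  forall n : int, schwartz (W n) /\
    forall xi : R * R, fourier (W n) xi = (w (norm2 xi / 2 ^ n))%:C.

Definition besov_norm (R : realType) (W : int -> R * R -> R[i])
    (T : (R * R -> R[i]) -> R[i]) : \bar R :=
  \esum_(n in [set: int])
    ((2 ^ n)%:E *
     Lnorm (leb2 R) +oo (fun x => (cabs (distr_conv T (W n) x))%:E))%E.

Definition besov_distr (R : realType) (W : int -> R * R -> R[i])
    (T : (R * R -> R[i]) -> R[i]) : Prop :=
  [/\ tempered T, (besov_norm W T < +oo)%E &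
      forall (b : bool) (phi : R * R -> R[i]), schwartz phi ->
        csumZ (fun n => distr_partial b (distr_of (distr_conv T (W n))) phi)
              (distr_partial b T phi)].

(** A distribution of the class is identified with the continuously
    differentiable function representing it; integrability against every
    Schwartz function ensures that [distr_of f] is that distribution. *)
Definition besov (R : realType) (W : int -> R * R -> R[i])
    (f : R * R -> R[i]) : Prop :=
  [/\ C1 f,
      forall phi : R * R -> R[i], schwartz phi ->
        cintegrable (fun x => f x * phi x) &
      besov_distr W (distr_of f)].

Definition hnorm (R : realType) (H : lmodType R[i]) (dot : {dot H for Num.conj})
    (x : H) : R :=
  Num.sqrt (complex.Re (dot x x)).

Definition hilbert (R : realType) (H : lmodType R[i])
    (dot : {dot H for Num.conj}) : Prop :=
  forall u : nat -> H,
    (forall e : R, 0 < e -> exists N : nat, forall m n : nat,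
       (N <= m)%N -> (N <= n)%N -> hnorm dot (u m - u n) < e) ->
    exists l : H, (fun n => hnorm dot (u n - l)) @ \oo --> (0 : R).

Definition spanned (R : realType) (H : lmodType R[i]) (m : nat)
    (e : 'I_m -> H) : set H :=
  [set x | exists c : 'I_m -> R[i], x = \sum_(i < m) c i *: e i].

Definition infinite_dim (R : realType) (H : lmodType R[i]) : Prop :=
  forall (m : nat) (e : 'I_m -> H), exists x : H, ~ spanned e x.

Definition rank_le (R : realType) (H : lmodType R[i]) (T : H -> H)
    (m : nat) : Prop :=
  exists e : 'I_m -> H, forall x : H, spanned e (T x).

Definition finite_rank (R : realType) (H : lmodType R[i]) (T : H -> H) : Prop :=
  exists m : nat, rank_le T m.

(** Everywhere defined symmetric operators are bounded, hence self-adjoint. *)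
Definition self_adjoint (R : realType) (H : lmodType R[i])
    (dot : {dot H for Num.conj}) (A : H -> H) : Prop :=
  forall x y : H, dot (A x) y = dot x (A y).

Definition opnorm (R : realType) (H : lmodType R[i])
    (dot : {dot H for Num.conj}) (T : H -> H) : \bar R :=
  ereal_sup [set (hnorm dot (T x))%:E | x in [set x | hnorm dot x <= 1]].

(** Singular values [s_j(T)], [j >= 0], as approximation numbers. *)
Definition singular_value (R : realType) (H : lmodType R[i])
    (dot : {dot H for Num.conj}) (T : H -> H) (j : nat) : \bar R :=
  ereal_inf [set opnorm dot (fun x => T x - K x) | K in
    [set K : {linear H -> H} | (opnorm dot K < +oo)%E /\ rank_le K j]].

Definition schatten_norm (R : realType) (H : lmodType R[i])
    (dot : {dot H for Num.conj}) (p : R) (T : H -> H) : \bar R :=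
  ((\sum_(0 <= j <oo) (singular_value dot T j `^ p)) `^ p^-1)%E.

(** Real part of the spectrum, which is all of it for self-adjoint [A]. *)
Definition spectrum (R : realType) (H : lmodType R[i])
    (dot : {dot H for Num.conj}) (A : H -> H) : set R :=
  [set l | ~ exists S : {linear H -> H},
    [/\ (opnorm dot S < +oo)%E,
        forall x : H, S (A x - l%:C *: x) = x &
        forall x : H, A (S x) - l%:C *: S x = x]].

Definition orth_proj (R : realType) (H : lmodType R[i])
    (dot : {dot H for Num.conj}) (M : set H) (x : H) : H :=
  xget 0 [set y | M y /\ forall z : H, M z -> dot (x - y) z = 0].

(** [E_A(D)] for a finite rank self-adjoint [A]: its spectrum is a finite set
    of eigenvalues, and [E_A] is the sum of the point masses at these given by
    the orthogonal projections onto the eigenspaces. *)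
Definition spectral_measure (R : realType) (H : lmodType R[i])
    (dot : {dot H for Num.conj}) (A : H -> H) (D : set R) (x : H) : H :=
  \sum_(l \in spectrum dot A `&` D)
    orth_proj dot [set y | A y = l%:C *: y] x.

Definition fun_calc (R : realType) (H : lmodType R[i])
    (dot : {dot H for Num.conj}) (f : R * R -> R[i]) (A B : H -> H) (x : H) :
    H :=
  \sum_(lm \in spectrum dot A `*` spectrum dot B)
    f lm *: spectral_measure dot A [set lm.1]
              (spectral_measure dot B [set lm.2] x).

(* Main.v *)
(** A trigonometric polynomial [f] with all frequencies in the annulus
    [2 < |xi| < 4] is the sum of [f * W_1] and [f * W_2], its other [f * W_n]
    being zero, so its Besov norm is at most a constant times its supremum norm,
    and it can be normalised.

    Let [Phi] be the Fejer kernel with period [4 pi N] and [Phi 0 = 1]. Then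
    [f(x, y) = e^(3ix) sum_(j <= N) Phi(x - 4 pi j) e^(-ijy/(2N))] has modulus at
    most 1 because the translates of [Phi] are nonnegative and sum up to 1. Let
    [A_1] and [B] have eigenvalues [4 pi j], [1 <= j <= N], on two orthonormal
    bases [e] and [h] of the same space that are related by the unitary discrete
    Fourier transform. The phases of [f] at the nodes cancel those of the matrix
    of inner products, so that [<f(A_1, B) v, u> = sqrt N] for the unit vectors [v]
    and [u] proportional to [sum h_k] and [sum e_i]. Replacing [A_1] by
    [A_2 = A_1 + d] on the span of [e] turns this into
    [sqrt N e^(3id) Phi(d)], and the difference is at least [sqrt N |sin (3d)|],
    whereas the norm of [A_1 - A_2] in [S_p] is at most [N^(1/p) d]. For [p > 2]
    the sequences [N] and [d] can be chosen so that the latter tends to 0 and the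
    former to infinity. The case of the operator norm follows from [p = 3], as it
    is dominated by the norm of [S_p]. *)

Require Import Defs.
From HB Require Import structures.
From mathcomp Require Import all_boot all_order all_algebra.
From mathcomp Require Import all_classical all_reals all_analysis.
From mathcomp Require Import sesquilinear complex.
From mathcomp Require Import measurable_realfun ess_sup_inf zify ring lra.
Import Order.TTheory GRing.Theory Num.Theory.
Import numFieldNormedType.Exports.
Local Open Scope classical_set_scope.
Local Open Scope complex_scope.
Local Open Scope ring_scope.

Set Implicit Arguments.
Unset Strict Implicit.
Unset Printing Implicit Defensive.

(** * Lebesgue measure on the plane *)

(* The library instance takes the measurability of [f] as an argument, which
   canonical structure inference cannot supply. *)
Definition pushforward_measure d d' (T1 : measurableType d)
    (T2 : measurableType d') (R : realFieldType)
    (m : {measure set T1 -> \bar R}) (f : T1 -> T2)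
    (mf : measurable_fun [set: T1] f) : {measure set T2 -> \bar R} :=
  measure_function_pushforward__canonical__measure_function_Measure m mf.

Section plane_measure.
Variable R : realType.
Local Notation R2 := (measurableTypeR R * measurableTypeR R)%type.

(** The plane carries the product sigma-algebra, so its topology has to be related to it: an open
    set is the countable union of the open boxes with rational corners that it contains. *)
Lemma open_measurable2 (O : set (R * R)) : open O -> measurable (O : set R2).
Proof.
move=> oO.
pose box (q : (rat * rat) * (rat * rat)) : set R2 :=
  `]ratr q.1.1, ratr q.1.2[%classic `*` `]ratr q.2.1, ratr q.2.2[%classic.
have -> : O = \bigcup_(q in [set q | box q `<=` O]) box q.
  apply/seteqP; split => [[x y] Oxy|z [q /= qO]]; last exact: qO.
  have /nbhs_ballP[e e0 eO] : nbhs (x, y) O by exact: open_nbhs_nbhs.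
  have lt1 (t : R) : t - e < t by rewrite ltrBlDr ltrDl.
  have lt2 (t : R) : t < t + e by rewrite ltrDl.
  have [a] := rat_in_itvoo (lt1 x); rewrite in_itv/= => /andP[a1 a2].
  have [b] := rat_in_itvoo (lt2 x); rewrite in_itv/= => /andP[b1 b2].
  have [c] := rat_in_itvoo (lt1 y); rewrite in_itv/= => /andP[c1 c2].
  have [d] := rat_in_itvoo (lt2 y); rewrite in_itv/= => /andP[d1 d2].
  exists ((a, b), (c, d)); last first.
    by split => /=; rewrite in_itv/= ?a2 ?b1 ?c2 ?d1.
  move=> [u v] [/=]; rewrite !in_itv/= => /andP[u1 u2] /andP[v1 v2].
  apply: eO; split; rewrite /ball/= ltr_norml; apply/andP; split; lra.
rewrite bigcup_mkcond; apply: countable_bigcupT_measurable => // q.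
by case: ifP => // _; apply: measurableX; exact: measurable_itv.
Qed.

Lemma continuous_measurable2 (g : R * R -> R) :
  continuous g -> measurable_fun [set: R2] (g : R2 -> R).
Proof.
move=> cg; apply: (measurability _ (RGenOpens.measurableE R)).
move=> _ [_ [a [b ->] <-]]; rewrite setTI; apply: open_measurable2.
by move/continuousP : cg; apply; exact: interval_open.
Qed.

Lemma measurable_subx (x : R) :
  measurable_fun [set: measurableTypeR R]
    (fun y : measurableTypeR R => x - y : measurableTypeR R).
Proof. exact: measurable_funB. Qed.

(** Both sides are measures in [A], so it suffices to compare them on half-open intervals, where the
    reflection only moves the closed end to the other side. *)
Lemma lebesgue_measure_subx (x : R) (A : set (measurableTypeR R)) :
  measurable A ->
  lebesgue_measure A = lebesgue_measure ((fun y => x - y) @^-1` A).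
Proof.
move=> mA; pose m' := pushforward_measure (@lebesgue_measure R) (measurable_subx x).
rewrite -[RHS]/(m' A).
apply: lebesgue_measure_unique => // _ [[a b] _ <-]; rewrite /m' /=.
rewrite /pushforward.
have -> : (fun y => x - y) @^-1` `]a, b]%classic = `[x - b, x - a[%classic.
  apply/seteqP; split => y /=; rewrite !in_itv/= => /andP[h1 h2];
    apply/andP; split; lra.
rewrite !lebesgue_measure_itv/= !lte_fin.
have -> : (x - b < x - a) = (a < b) by apply/idP/idP; lra.
by case: ifP => // _; rewrite -!EFinB; congr EFin; lra.
Qed.

Lemma measurable_sub2 (x : R * R) :
  measurable_fun [set: R2] (fun y : R2 => (x - y : R2)).
Proof.
apply/measurable_fun_pairP; split.
  by apply: (measurableT_comp (measurable_subx x.1)); exact: measurable_fst.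
by apply: (measurableT_comp (measurable_subx x.2)); exact: measurable_snd.
Qed.

Lemma pushforward_sub2_leb2 (x : R * R) (A : set R2) : measurable A ->
  leb2 R A = pushforward_measure (leb2 R) (measurable_sub2 x) A.
Proof.
move=> mA; apply: product_measure_unique => // B C mB mC.
have -> : pushforward_measure (leb2 R) (measurable_sub2 x) (B `*` C) = leb2 R
    (((fun y => x.1 - y) @^-1` B) `*` ((fun y => x.2 - y) @^-1` C)) by [].
have mS (t : R) (D : set R) : measurable D -> measurable ((fun y => t - y) @^-1` D).
  by move=> mD; rewrite -[X in measurable X]setTI; exact: measurable_subx.
apply: etrans.
  exact: (product_measure1E (@lebesgue_measure R) (@lebesgue_measure R)
    (mS x.1 _ mB) (mS x.2 _ mC)).
by congr (_ * _)%E; symmetry; exact: lebesgue_measure_subx.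
Qed.

Lemma integral_pushforward_sub2 (x : R * R) (h : R2 -> \bar R) :
  (\int[pushforward (leb2 R) (fun y : R2 => (x - y)%R : R2)]_y h y =
   \int[leb2 R]_y h y)%E.
Proof.
apply: (@eq_measure_integral _ _ _ _ (leb2 R)
  (pushforward_measure (leb2 R) (measurable_sub2 x))) => A mA _.
by symmetry; exact: pushforward_sub2_leb2.
Qed.

Lemma integrable_sub2 (x : R * R) (g : R * R -> R) : continuous g ->
  (leb2 R).-integrable setT (EFin \o g) ->
  (leb2 R).-integrable setT (EFin \o (fun y => g (x - y))).
Proof.
move=> cg ig; have mg : measurable_fun setT (EFin \o (g : R2 -> R)).
  by apply/measurable_EFinP; exact: continuous_measurable2.
apply/integrableP; split; first by apply: (measurableT_comp mg); exact: measurable_sub2.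
move/integrableP : ig => [_].
rewrite -(integral_pushforward_sub2 x) ge0_integral_pushforward//.
- exact: measurable_sub2.
- exact: measurableT_comp.
Qed.

Lemma Rintegral_sub2 (x : R * R) (g : R * R -> R) : continuous g ->
  (leb2 R).-integrable setT (EFin \o g) ->
  Rintegral (leb2 R) setT (fun y => g (x - y)) = Rintegral (leb2 R) setT g.
Proof.
move=> cg ig; rewrite /Rintegral; congr fine.
rewrite -[RHS](integral_pushforward_sub2 x) integral_pushforward//.
- exact: measurable_sub2.
- by apply/measurable_EFinP; exact: continuous_measurable2.
- exact: integrable_sub2.
Qed.

(** An integrable majorant of Schwartz functions. Its product form lets Tonelli's theorem reduce its
    integral to that of [1 / (1 + t^2)] on the line. *)
Definition decay2 (x : R * R) : R := (oneDsqr x.1)^-1 * (oneDsqr x.2)^-1.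

Lemma integral_oneDsqrV_lty :
  (\int[@lebesgue_measure R]_x ((oneDsqr x)^-1)%:E < +oo)%E.
Proof.
rewrite ge0_symfun_integralT.
- by rewrite -set_itvcy integral0y_oneDsqr -EFinM ltry.
- by move=> x; rewrite invr_ge0.
- by move=> x; exact: continuous_oneDsqrV.
- by move=> x /=; rewrite /oneDsqr sqrrN.
Qed.

Lemma decay2_ge0 (x : R * R) : 0 <= decay2 x.
Proof. by rewrite mulr_ge0 ?invr_ge0. Qed.

Lemma integrable_decay2 : (leb2 R).-integrable setT (EFin \o decay2).
Proof.
have mV : measurable_fun setT (fun x : R => (oneDsqr x)^-1 : R).
  by apply: continuous_measurable_fun => x; exact: continuous_oneDsqrV.
have md : measurable_fun setT (EFin \o decay2).
  apply/measurable_EFinP; apply: measurable_funM.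
    by apply: (measurableT_comp mV); exact: measurable_fst.
  by apply: (measurableT_comp mV); exact: measurable_snd.
apply/integrableP; split => //.
under eq_integral do rewrite gee0_abs ?lee_fin ?decay2_ge0//.
rewrite /leb2 fubini_tonelli1//=; last first.
  by move=> x; rewrite lee_fin decay2_ge0.
pose I := (\int[@lebesgue_measure R]_x ((oneDsqr x)^-1)%:E)%E.
have I0 : (0 <= I)%E by apply: integral_ge0 => x _; rewrite lee_fin invr_ge0.
rewrite (_ : (\int[_]_x _ =
    \int[@lebesgue_measure R]_x (((oneDsqr x)^-1)%:E * I))%E); last first.
  apply: eq_integral => x _; rewrite /fubini_F /I -ge0_integralZl//.
  exact/measurable_EFinP.
rewrite ge0_integralZr//.
  by rewrite lte_mul_pinfty ?integral_oneDsqrV_lty// ge0_fin_numE//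
    integral_oneDsqrV_lty.
exact/measurable_EFinP.
Qed.

Lemma integrable_le_decay2 (g : R * R -> R) (K : R) : continuous g ->
  (forall x, `|g x| <= K * decay2 x) ->
  (leb2 R).-integrable setT (EFin \o g).
Proof.
move=> cg gK; apply: (@le_integrable _ _ _ (leb2 R) _ measurableT _
  (EFin \o (fun x => K * decay2 x))) => //.
- by apply/measurable_EFinP; exact: continuous_measurable2.
- move=> x _ /=; rewrite lee_fin; apply: (le_trans (gK x)); exact: ler_norm.
- exact: (integrableZl measurableT K integrable_decay2).
Qed.

End plane_measure.

(** * Integrals of complex functions *)

Section complex_integral.
Variable R : realType.
Implicit Types (g h : R * R -> R[i]).

Lemma ReM (x y : R[i]) :
  complex.Re (x * y) = complex.Re x * complex.Re y - complex.Im x * complex.Im y.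
Proof. by case: x y => [a b] [c d]. Qed.

Lemma ImM (x y : R[i]) :
  complex.Im (x * y) = complex.Re x * complex.Im y + complex.Im x * complex.Re y.
Proof. by case: x y => [a b] [c d]. Qed.

Lemma ReD (x y : R[i]) : complex.Re (x + y) = complex.Re x + complex.Re y.
Proof. by case: x y => [a b] [c d]. Qed.

Lemma ImD (x y : R[i]) : complex.Im (x + y) = complex.Im x + complex.Im y.
Proof. by case: x y => [a b] [c d]. Qed.

Lemma ImN (x : R[i]) : complex.Im (- x) = - complex.Im x.
Proof. by case: x. Qed.

Lemma complex_eq (x y : R[i]) :
  complex.Re x = complex.Re y -> complex.Im x = complex.Im y -> x = y.
Proof. by case: x y => [a b] [c d] /= -> ->. Qed.

Lemma cabs_ge0 (x : R[i]) : 0 <= cabs x.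
Proof. by case: x => a b; exact: sqrtr_ge0. Qed.

Lemma cabs_real (t : R) : cabs t%:C = `|t|.
Proof. by rewrite /= expr0n addr0 sqrtr_sqr. Qed.

Lemma normr_Re (x : R[i]) : `|complex.Re x| <= cabs x.
Proof. by case: x => a b /=; rewrite -sqrtr_sqr ler_wsqrtr// lerDl sqr_ge0. Qed.

Lemma normr_Im (x : R[i]) : `|complex.Im x| <= cabs x.
Proof. by case: x => a b /=; rewrite -sqrtr_sqr ler_wsqrtr// lerDr sqr_ge0. Qed.

Lemma cabs_le (x : R[i]) : cabs x <= `|complex.Re x| + `|complex.Im x|.
Proof.
case: x => a b /=; rewrite -[leRHS]ger0_norm ?addr_ge0// -sqrtr_sqr ler_wsqrtr//.
rewrite sqrrD !real_normK ?num_real// lerD2r lerDl mulrn_wge0// mulr_ge0//.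
Qed.

(** The integrands used below: closed under sums and under multiplication by functions in
    [cbounded], and integrable by domination. *)
Definition decaying g :=
  ccontinuous g /\ exists K, forall x, cabs (g x) <= K * decay2 x.

Definition cbounded g := ccontinuous g /\ exists M, forall x, cabs (g x) <= M.

Lemma ccontinuousM g h : ccontinuous g -> ccontinuous h ->
  ccontinuous (fun x => g x * h x).
Proof.
move=> [g1 g2] [h1 h2]; split => x.
  rewrite /continuous_at ReM; under eq_fun do rewrite ReM.
  by apply: cvgB; apply: cvgM; [exact: g1|exact: h1|exact: g2|exact: h2].
rewrite /continuous_at ImM; under eq_fun do rewrite ImM.
by apply: cvgD; apply: cvgM; [exact: g1|exact: h2|exact: g2|exact: h1].
Qed.

Lemma ccontinuousD g h : ccontinuous g -> ccontinuous h ->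
  ccontinuous (fun x => g x + h x).
Proof.
move=> [g1 g2] [h1 h2]; split => x.
  rewrite /continuous_at ReD; under eq_fun do rewrite ReD.
  by apply: cvgD; [exact: g1|exact: h1].
rewrite /continuous_at ImD; under eq_fun do rewrite ImD.
by apply: cvgD; [exact: g2|exact: h2].
Qed.

Lemma ccontinuous_cst (a : R[i]) : ccontinuous (fun _ : R * R => a).
Proof. by split => x; exact: cvg_cst. Qed.

Lemma decaying_cintegrable g : decaying g -> cintegrable g.
Proof.
move=> [[g1 g2] [K gK]]; split; apply: (@integrable_le_decay2 _ _ K) => // x;
  apply: le_trans (gK x); [exact: normr_Re|exact: normr_Im].
Qed.

Lemma cboundedM_decaying g h : cbounded g -> decaying h ->
  decaying (fun x => g x * h x).
Proof.
move=> [cg [M gM]] [ch [K hK]]; split; first exact: ccontinuousM.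
exists (M * K) => x; rewrite ComplexField.Normc.normcM -mulrA.
by apply: ler_pM => //; exact: cabs_ge0.
Qed.

Lemma decayingD g h : decaying g -> decaying h -> decaying (fun x => g x + h x).
Proof.
move=> [cg [M gM]] [ch [K hK]]; split; first exact: ccontinuousD.
exists (M + K) => x; rewrite mulrDl; apply: le_trans (lerD (gM x) (hK x)).
exact: le_normcD.
Qed.

Lemma cbounded_cst (a : R[i]) : cbounded (fun _ : R * R => a).
Proof. by split; [exact: ccontinuous_cst|exists (cabs a)]. Qed.

Lemma decaying0 : decaying (fun _ : R * R => 0).
Proof.
split; first exact: ccontinuous_cst.
by exists 0 => x; rewrite ComplexField.Normc.normc0 mul0r.
Qed.

Lemma decaying_sum (I : Type) (r : seq I) (P : pred I) (F : I -> R * R -> R[i]) :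
  (forall i, decaying (F i)) -> decaying (fun x => \sum_(i <- r | P i) F i x).
Proof.
move=> dF; elim: r => [|i r IH].
  by under eq_fun do rewrite big_nil; exact: decaying0.
under eq_fun do rewrite big_cons.
by case: (P i) => //; exact: decayingD.
Qed.

Lemma cintegral_lin (a : R[i]) g h : cintegrable g -> cintegrable h ->
  cintegral (fun x => a * g x + h x) = a * cintegral g + cintegral h.
Proof.
move=> [g1 g2] [h1 h2].
have iZ (k : R) (u : R * R -> R) : (leb2 R).-integrable setT (EFin \o u) ->
    (leb2 R).-integrable setT (EFin \o (fun x => k * u x)).
  by move=> iu; exact: (integrableZl measurableT k iu).
have iD (u v : R * R -> R) : (leb2 R).-integrable setT (EFin \o u) ->
    (leb2 R).-integrable setT (EFin \o v) ->
    (leb2 R).-integrable setT (EFin \o (fun x => u x + v x)).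
  by move=> iu iv; exact: (integrableD measurableT iu iv).
have iB (u v : R * R -> R) : (leb2 R).-integrable setT (EFin \o u) ->
    (leb2 R).-integrable setT (EFin \o v) ->
    (leb2 R).-integrable setT (EFin \o (fun x => u x - v x)).
  by move=> iu iv; exact: (integrableB measurableT iu iv).
apply: complex_eq; rewrite ?ReD ?ImD ?ReM ?ImM /=.
  under [LHS]eq_Rintegral do rewrite ReD ReM.
  rewrite RintegralD//; [|by apply: iB; exact: iZ].
  rewrite RintegralB//; [|exact: iZ|exact: iZ].
  by rewrite !RintegralZl.
under [LHS]eq_Rintegral do rewrite ImD ImM.
rewrite RintegralD//; [|by apply: iD; exact: iZ].
rewrite RintegralD//; [|exact: iZ|exact: iZ].
by rewrite !RintegralZl.
Qed.

Lemma cintegral0 : cintegral (fun _ : R * R => 0) = 0.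
Proof.
by rewrite /cintegral /Rintegral integral0.
Qed.

Lemma cintegralZ (a : R[i]) g : decaying g ->
  cintegral (fun x => a * g x) = a * cintegral g.
Proof.
move=> dg; have := @cintegral_lin a g (fun=> 0) (decaying_cintegrable dg)
  (decaying_cintegrable decaying0).
rewrite cintegral0 addr0 => <-; congr cintegral; apply/funext => x.
by rewrite addr0.
Qed.

Lemma cintegralD g h : decaying g -> decaying h ->
  cintegral (fun x => g x + h x) = cintegral g + cintegral h.
Proof.
move=> /decaying_cintegrable dg /decaying_cintegrable dh.
rewrite -[X in X + _]mul1r -cintegral_lin//.
by congr cintegral; apply/funext => x; rewrite mul1r.
Qed.

Lemma cintegral_sum (I : Type) (r : seq I) (P : pred I) (F : I -> R * R -> R[i]) :
  (forall i, decaying (F i)) ->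
  cintegral (fun x => \sum_(i <- r | P i) F i x) =
  \sum_(i <- r | P i) cintegral (F i).
Proof.
move=> dF; elim: r => [|i r IH].
  by under eq_fun do rewrite big_nil; rewrite big_nil cintegral0.
under eq_fun do rewrite big_cons.
rewrite big_cons; case: (P i) => //; rewrite cintegralD// ?IH//.
exact: decaying_sum.
Qed.

Lemma cintegral_sub2 (x : R * R) g : decaying g ->
  cintegral (fun y => g (x - y)) = cintegral g.
Proof.
move=> dg; have [i1 i2] := decaying_cintegrable dg; case: dg => [[g1 g2] _].
by congr (_ +i* _); [rewrite (Rintegral_sub2 x g1 i1)|rewrite (Rintegral_sub2 x g2 i2)].
Qed.

Definition decay2_mass : R := Rintegral (leb2 R) setT (@decay2 R).

(** The factor 2 comes from estimating the real and the imaginary part separately. *)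
Lemma cabs_cintegral_le g (K : R) : ccontinuous g ->
  (forall x, cabs (g x) <= K * decay2 x) ->
  cabs (cintegral g) <= 2 * K * decay2_mass.
Proof.
move=> cg gK; have dg : decaying g by split => //; exists K.
have [i1 i2] := decaying_cintegrable dg.
have H (u : R * R -> R) : (leb2 R).-integrable setT (EFin \o u) ->
    (forall x, `|u x| <= K * decay2 x) ->
    `|Rintegral (leb2 R) setT u| <= K * decay2_mass.
  move=> iu uK; apply: (le_trans (le_normr_Rintegral _ iu)) => //.
  rewrite /decay2_mass -RintegralZl//; last exact: integrable_decay2.
  apply: le_Rintegral => //.
    exact: (integrable_abse iu).
  exact: (integrableZl measurableT K (@integrable_decay2 R)).
apply: (le_trans (cabs_le _)); rewrite -mulrA mulr_natl mulr2n.
apply: lerD; apply: H => // x; apply: le_trans (gK x);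
  [exact: normr_Re|exact: normr_Im].
Qed.

(** Order 4 suffices because [1 + x_i^2 <= (1 + |x|)^2] for each of the two coordinates. *)
Lemma schwartz_le_decay2 (phi : R * R -> R[i]) : schwartz phi ->
  forall x, cabs (phi x) <= fine (schwartz_norm 4 phi) * decay2 x.
Proof.
move=> [_ /(_ 4%N) phi4] x.
have nx0 : 0 <= norm2 x by exact: sqrtr_ge0.
have b1 : oneDsqr x.1 <= (1 + norm2 x) ^+ 2.
  have := @sqr_sqrtr _ (x.1 ^+ 2 + x.2 ^+ 2); rewrite -/(norm2 x) => E.
  rewrite /oneDsqr; have := E (addr_ge0 (sqr_ge0 _) (sqr_ge0 _)).
  by have := sqr_ge0 x.2; nra.
have b2 : oneDsqr x.2 <= (1 + norm2 x) ^+ 2.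
  have := @sqr_sqrtr _ (x.1 ^+ 2 + x.2 ^+ 2); rewrite -/(norm2 x) => E.
  rewrite /oneDsqr; have := E (addr_ge0 (sqr_ge0 _) (sqr_ge0 _)).
  by have := sqr_ge0 x.1; nra.
have h : (((1 + norm2 x) ^+ 4 * cabs (phi x))%:E <= schwartz_norm 4 phi)%E.
  by apply: ereal_sup_ubound; exists [::], x.
have fin : schwartz_norm 4 phi \is a fin_num.
  rewrite ge0_fin_numE//; apply: le_trans h; rewrite lee_fin.
  by rewrite mulr_ge0 ?cabs_ge0// exprn_ge0// addr_ge0.
have o1 : 0 < oneDsqr x.1 by exact: lt_le_trans (oneDsqr_ge1 _).
have o2 : 0 < oneDsqr x.2 by exact: lt_le_trans (oneDsqr_ge1 _).
rewrite /decay2 -invfM ler_pdivlMr ?mulr_gt0//.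
move: h; rewrite -[X in (_ <= X)%E]fineK// lee_fin; apply: le_trans.
rewrite mulrC ler_wpM2r ?cabs_ge0// (exprD _ 2 2).
by apply: ler_pM => //; exact: ltW.
Qed.

Lemma schwartz_decaying (phi : R * R -> R[i]) : schwartz phi -> decaying phi.
Proof.
move=> sphi; split; first by case: sphi => /(_ [::]) [].
by exists (fine (schwartz_norm 4 phi)); exact: schwartz_le_decay2.
Qed.

Lemma schwartz_partial (b : bool) (phi : R * R -> R[i]) :
  schwartz phi -> schwartz (partial b phi).
Proof.
move=> [sm nm].
have pE s : partials s (partial b phi) = partials (rcons s b) phi.
  by rewrite /partials -cats1 foldr_cat.
split => [s|N]; first by rewrite pE; exact: sm.
(* The additional derivative costs one order; the weight of order [N.+1] is only larger since its
   base is at least 1. *)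
apply: le_lt_trans (nm N.+1); apply: ge_ereal_sup => _ [s [x [sN ->]]].
apply: (@le_trans _ _ ((1 + norm2 x) ^+ N.+1 *
    cabs (partials (rcons s b) phi x))%:E).
  rewrite lee_fin pE exprS -mulrA ler_peMl//.
    by rewrite mulr_ge0 ?cabs_ge0// exprn_ge0// addr_ge0// sqrtr_ge0.
  by rewrite lerDl sqrtr_ge0.
by apply: ereal_sup_ubound; exists (rcons s b), x; rewrite size_rcons.
Qed.

End complex_integral.

(** * Trigonometric polynomials and their Besov norms *)

Section trigonometric_polynomials.
Variable R : realType.

Lemma cisD (s t : R) : cis (s + t) = cis s * cis t.
Proof.
by apply: complex_eq; rewrite ?ReM ?ImM /= ?cosD ?sinD// addrC.
Qed.

Lemma cis0 : cis (0 : R) = 1.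
Proof. by rewrite /cis cos0 sin0. Qed.

Lemma cabs_cis (t : R) : cabs (cis t) = 1.
Proof. by rewrite /= cos2Dsin2 sqrtr1. Qed.

Definition wave (xi x : R * R) : R[i] := cis (x.1 * xi.1 + x.2 * xi.2).

Definition trigpoly (I : finType) (c : I -> R[i]) (xi : I -> R * R)
    (x : R * R) : R[i] :=
  \sum_i c i * wave (xi i) x.

(** Reduces directional derivatives in the plane to derivatives on the line, where the chain rule
    for one variable applies. *)
Lemma is_derive_line (f : R * R -> R) (x v : R * R) (d : R) :
  is_derive (0 : R) 1 (fun h => f (h *: v + x)) d -> is_derive x v f d.
Proof.
move=> [dk dkE].
have E : (fun h : R => h^-1 *: ((f \o shift x) (h *: v) - f x)) =
    (fun h : R => h^-1 *: (((fun h => f (h *: v + x)) \o shift 0) (h *: 1) -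
       f (0 *: v + x))).
  by apply/funext => h /=; rewrite !scale0r !add0r addr0 [h *: 1]mulr1.
by split; [rewrite /derivable E|rewrite /derive E].
Qed.

Lemma is_derive_phase (F : R -> R) (dF : R) (xi x v : R * R) :
  is_derive (x.1 * xi.1 + x.2 * xi.2) 1 F dF ->
  is_derive x v (fun y => F (y.1 * xi.1 + y.2 * xi.2))
    (dF * (v.1 * xi.1 + v.2 * xi.2)).
Proof.
move=> hF; apply: is_derive_line => /=.
set a := v.1 * xi.1 + v.2 * xi.2; set b := x.1 * xi.1 + x.2 * xi.2.
have -> : (fun h : R => F ((h *: v.1 + x.1) * xi.1 + (h *: v.2 + x.2) * xi.2)) =
    F \o (fun h => a * h + b).
  by apply/funext => h /=; congr F; rewrite /a /b /GRing.scale /=; ring.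
apply: is_derive1_comp.
  by rewrite mulr0 add0r.
rewrite (_ : (fun h => a * h + b) = a \*: id + cst b)//.
by apply: is_derive_eq; rewrite addr0 [_ *: _]mulr1.
Qed.

Lemma is_derive_bigsum (I : Type) (r : seq I) (F : I -> R * R -> R)
    (dF : I -> R) (x v : R * R) :
  (forall i, is_derive x v (F i) (dF i)) ->
  is_derive x v (fun y => \sum_(i <- r) F i y) (\sum_(i <- r) dF i).
Proof.
move=> hF; elim: r => [|i r IH].
  under eq_fun do rewrite big_nil; rewrite big_nil; exact: is_derive_cst.
under eq_fun do rewrite big_cons.
by rewrite big_cons; exact: is_deriveD.
Qed.

Section fixed.
Variables (I : finType) (c : I -> R[i]) (xi : I -> R * R).
Local Notation P := (trigpoly c xi).

Lemma Re_sum (J : Type) (r : seq J) (F : J -> R[i]) :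
  complex.Re (\sum_(i <- r) F i) = \sum_(i <- r) complex.Re (F i).
Proof. by apply: big_morph => // x y; exact: ReD. Qed.

Lemma Im_sum (J : Type) (r : seq J) (F : J -> R[i]) :
  complex.Im (\sum_(i <- r) F i) = \sum_(i <- r) complex.Im (F i).
Proof. by apply: big_morph => // x y; exact: ImD. Qed.

Definition freq (b : bool) (z : R * R) : R := if b then z.2 else z.1.

(** Differentiation multiplies each coefficient by [i] times a component of its frequency, so a
    partial derivative is again a trigonometric polynomial with the same frequencies. *)
Let dc (b : bool) (i : I) : R[i] := c i * (0 +i* freq b (xi i)).

Lemma is_derive_trigpoly (b : bool) (x : R * R) :
  is_derive x (dir R b) (fun y => complex.Re (P y))
    (complex.Re (trigpoly (dc b) xi x)) /\
  is_derive x (dir R b) (fun y => complex.Im (P y))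
    (complex.Im (trigpoly (dc b) xi x)).
Proof.
have dirE (z : R * R) : (dir R b).1 * z.1 + (dir R b).2 * z.2 = freq b z.
  by rewrite /dir /freq; case: b => /=; rewrite mul0r mul1r ?add0r ?addr0.
split.
  under eq_fun do rewrite Re_sum.
  rewrite Re_sum; apply: is_derive_bigsum => i.
  under eq_fun do rewrite ReM /=.
  apply: is_derive_eq.
    apply: (@is_derive_phase (complex.Re (c i) \*: @cos R - complex.Im (c i) \*: @sin R)).
  by rewrite dirE /dc !(ReM, ImM)/= /GRing.scale/=; ring.
under eq_fun do rewrite Im_sum.
rewrite Im_sum; apply: is_derive_bigsum => i.
under eq_fun do rewrite ImM /=.
apply: is_derive_eq.
  apply: (@is_derive_phase (complex.Re (c i) \*: @sin R + complex.Im (c i) \*: @cos R)).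
by rewrite dirE /dc !(ReM, ImM)/= /GRing.scale/=; ring.
Qed.

Lemma continuous_phase (z : R * R) :
  continuous (fun x : R * R => x.1 * z.1 + x.2 * z.2).
Proof.
move=> x; apply: cvgD; apply: cvgM; try exact: cvg_cst.
  exact: cvg_fst.
exact: cvg_snd.
Qed.

Lemma ccontinuous_wave (z : R * R) : ccontinuous (wave z).
Proof.
by split => x; apply: (@continuous_comp _ _ _ (fun x : R * R => x.1 * z.1 + x.2 * z.2));
  [exact: continuous_phase|exact: continuous_cos|exact: continuous_phase|
   exact: continuous_sin].
Qed.

End fixed.

Lemma ccontinuous_sum (I : Type) (r : seq I) (F : I -> R * R -> R[i]) :
  (forall i, ccontinuous (F i)) -> ccontinuous (fun x => \sum_(i <- r) F i x).
Proof.
move=> cF; elim: r => [|i r IH].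
  by under eq_fun do rewrite big_nil; exact: ccontinuous_cst.
under eq_fun do rewrite big_cons; exact: ccontinuousD.
Qed.

Lemma ccontinuous_trigpoly (I : finType) (c : I -> R[i]) (xi : I -> R * R) :
  ccontinuous (trigpoly c xi).
Proof.
apply: ccontinuous_sum => i; apply: ccontinuousM.
  exact: ccontinuous_cst.
exact: ccontinuous_wave.
Qed.

Lemma cabs_sum_le (I : Type) (r : seq I) (F : I -> R[i]) :
  cabs (\sum_(i <- r) F i) <= \sum_(i <- r) cabs (F i).
Proof.
elim: r => [|i r IH]; first by rewrite !big_nil ComplexField.Normc.normc0.
by rewrite !big_cons; apply: (le_trans (le_normcD _ _)); rewrite lerD2l.
Qed.

Lemma cbounded_trigpoly (I : finType) (c : I -> R[i]) (xi : I -> R * R) :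
  cbounded (trigpoly c xi).
Proof.
split; first exact: ccontinuous_trigpoly.
exists (\sum_i cabs (c i)) => x; apply: (le_trans (cabs_sum_le _ _)).
by apply: ler_sum => i _; rewrite ComplexField.Normc.normcM cabs_cis mulr1.
Qed.

Lemma C1_trigpoly (I : finType) (c : I -> R[i]) (xi : I -> R * R) :
  C1 (trigpoly c xi).
Proof.
split=> [b x|b].
  by have [[d1 _] [d2 _]] := is_derive_trigpoly c xi b x.
have -> : partial b (trigpoly c xi) =
    trigpoly (fun i => c i * (0 +i* freq b (xi i))) xi.
  apply/funext => x; rewrite /partial.
  have [[_ ->] [_ ->]] := is_derive_trigpoly c xi b x.
  exact: complex_eq.
exact: ccontinuous_trigpoly.
Qed.

End trigonometric_polynomials.

Lemma csumZ_two (R : realType) (a : int -> R[i]) :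
  (forall n, n != 1 -> n != 2 -> a n = 0) -> csumZ a (a 1 + a 2).
Proof.
move=> a0.
have ccvg_near (u : nat -> R[i]) l : (\forall n \near \oo, u n = l) -> ccvg u l.
  by move=> ul; split; apply: cvg_near_cst; apply: filterS ul => n ->.
(* Both surviving indices are nonnegative, so the negative half of the series is 0. *)
exists (a 1 + a 2), 0; split; last by rewrite addr0.
  apply: ccvg_near; near=> n.
  have n3 : (3 <= n)%N by near: n; exists 3%N.
  have -> : n = (n - 3).+3 by rewrite -[LHS](subnKC n3).
  rewrite !big_nat_recl// [X in X + _]a0// add0r.
  by rewrite [X in _ + (_ + X)]big_nat big1 ?addr0// => i _; exact: a0.
by apply: ccvg_near; apply: nearW => n; apply: big1 => i _; exact: a0.
Unshelve. all: by end_near.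
Qed.

(** * Dyadic pieces of a trigonometric polynomial with frequencies in the annulus *)

Section besov_norm_of_trigonometric_polynomials.
Variables (R : realType) (w : R -> R) (W : int -> R * R -> R[i]).
Hypotheses (hw : besov_window w) (hW : besov_kernels w W).

Lemma window_eq0 (s : R) : (s < 2^-1) || (2 < s) -> w s = 0.
Proof.
case: hw => _ _ supp _ s_out; apply/eqP/negP => /negP ws.
have /supp /= /andP[h1 h2] : closure [set s | w s != 0] s by exact: subset_closure.
by case/orP: s_out; lra.
Qed.

(** The point [s / 2] lies in [[1, 2]], where the defining identity of the window applies. *)
Lemma window_partition (s : R) : 2 < s < 4 -> w (s / 2) + w (s / 4) = 1.
Proof.
move=> /andP[s2 s4]; case: hw => _ _ _ E; rewrite E; last by apply/andP; split; lra.
by rewrite -mulrA -invfM (_ : 2 * 2 = 4) ?subrK//; lra.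
Qed.

(** For [n <= 0] the argument is at least [s > 2], and for [n >= 3] it is at most [s / 8 < 1/2];
    both are outside the support of the window. *)
Lemma dyadic_window_eq0 (s : R) (n : int) : 2 < s < 4 ->
  n != 1 -> n != 2 -> w (s / 2 ^ n) = 0.
Proof.
move=> /andP[s2 s4]; case: n => [[|[|[|k]]]|k] //= _ _; apply: window_eq0.
- by rewrite expr0z divr1 s2 orbT.
- have k8 : (8 : R) <= 2 ^+ k.+3.
    rewrite (_ : 8 = 2 ^+ 3); last by lra.
    by rewrite ler_weXn2l// ler1n.
  apply/orP; left; rewrite -exprnP ltr_pdivrMr; last by lra.
  lra.
- rewrite (_ : s / _ = s * 2 ^+ k.+1); last by rewrite /exprz invrK.
  have k2 : (1 : R) <= 2 ^+ k.+1 by rewrite exprn_ege1// ler1n.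
  by apply/orP; right; nra.
Qed.

Variables (I : finType) (c : I -> R[i]) (xi : I -> R * R).
Hypothesis (hxi : forall i, 2 < norm2 (xi i) < 4).

Local Notation P := (trigpoly c xi).

Definition wcoef (n : int) (i : I) : R[i] := c i * (w (norm2 (xi i) / 2 ^ n))%:C.

Lemma waveB (z x u : R * R) :
  wave z (x - u) = wave z x * cis (- (u.1 * z.1 + u.2 * z.2)).
Proof. by rewrite /wave -cisD; congr cis => /=; ring. Qed.

Lemma cbounded_cis (z : R * R) :
  cbounded (fun u : R * R => cis (- (u.1 * z.1 + u.2 * z.2))).
Proof.
have -> : (fun u : R * R => cis (- (u.1 * z.1 + u.2 * z.2))) = wave (- z).
  by apply/funext => u; rewrite /wave; congr cis => /=; ring.
split; first exact: ccontinuous_wave.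
by exists 1 => x; rewrite cabs_cis.
Qed.

Lemma cbounded_trigpoly_sub (x : R * R) : cbounded (fun u => P (x - u)).
Proof.
have -> : (fun u => P (x - u)) =
    trigpoly (fun i => c i * wave (xi i) x) (fun i => - xi i).
  apply/funext => u; apply: eq_bigr => i _; rewrite waveB mulrA; congr (_ * cis _).
  by rewrite /=; ring.
exact: cbounded_trigpoly.
Qed.

(** The substitution [y = x - u] moves the translation from the kernel to the polynomial, so that
    the decay bound for [W n] can be used as it stands, uniformly in [x]. *)
Lemma distr_conv_trigpolyE (n : int) (x : R * R) :
  distr_conv (distr_of P) (W n) x = cintegral (fun u => P (x - u) * W n u).
Proof.
have [sW _] := hW n.
rewrite /distr_conv /distr_of -(cintegral_sub2 x (g := fun u => P (x - u) * W n u)).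
  by congr cintegral; apply/funext => y; congr (P _ * _); rewrite subKr.
by apply: cboundedM_decaying; [exact: cbounded_trigpoly_sub|exact: schwartz_decaying].
Qed.

(* Convolution with [W n] multiplies each frequency by the Fourier transform of
   [W n], so only the frequencies in the shell of index [n] survive. *)
Lemma distr_conv_trigpoly (n : int) (x : R * R) :
  distr_conv (distr_of P) (W n) x = trigpoly (wcoef n) xi x.
Proof.
have [sW fW] := hW n.
rewrite distr_conv_trigpolyE.
transitivity (cintegral (fun u => \sum_i (c i * wave (xi i) x) *
    (W n u * cis (- (u.1 * (xi i).1 + u.2 * (xi i).2))))).
  congr cintegral; apply/funext => u; rewrite /trigpoly big_distrl/=.
  by apply: eq_bigr => i _; rewrite waveB; ring.
have dW i : decaying (fun u => W n u * cis (- (u.1 * (xi i).1 + u.2 * (xi i).2))).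
  under eq_fun do rewrite mulrC.
  by apply: cboundedM_decaying; [exact: cbounded_cis|exact: schwartz_decaying].
rewrite cintegral_sum; last first.
  by move=> i; apply: cboundedM_decaying => //; exact: cbounded_cst.
apply: eq_bigr => i _; rewrite cintegralZ//.
rewrite -[cintegral _]/(fourier (W n) (xi i)) fW /wcoef.
by rewrite mulrAC.
Qed.

Lemma wcoef_eq0 (n : int) : n != 1 -> n != 2 -> trigpoly (wcoef n) xi = fun=> 0.
Proof.
move=> n1 n2; apply/funext => x; apply: big1 => i _.
by rewrite /wcoef dyadic_window_eq0// mulr0 mul0r.
Qed.

Lemma trigpoly_split (x : R * R) :
  P x = trigpoly (wcoef 1) xi x + trigpoly (wcoef 2) xi x.
Proof.
rewrite /trigpoly -big_split/=; apply: eq_bigr => i _.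
rewrite -mulrDl -mulrDr -rmorphD/= expr1z.
by rewrite (_ : 2 ^ 2 = 4) ?window_partition ?mulr1// -exprnP; lra.
Qed.

Lemma tempered_trigpoly : tempered (distr_of P).
Proof.
split=> [a phi psi sphi spsi|].
  have dphi := cboundedM_decaying (cbounded_trigpoly c xi) (schwartz_decaying sphi).
  have dpsi := cboundedM_decaying (cbounded_trigpoly c xi) (schwartz_decaying spsi).
  rewrite /distr_of -cintegral_lin; [|exact: decaying_cintegrable..].
  by congr cintegral; apply/funext => x; rewrite mulrDr mulrCA.
have [cP [M PM]] := cbounded_trigpoly c xi.
(* The integrand is at most [M |phi|], and [schwartz_le_decay2] bounds [phi] by its seminorm of
   order 4. *)
exists 4%N, (2 * M * decay2_mass R) => phi sphi.
have M0 : 0 <= M by exact: le_trans (cabs_ge0 _) (PM (0, 0)).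
have dphi := cboundedM_decaying (cbounded_trigpoly c xi) (schwartz_decaying sphi).
have fin : schwartz_norm 4 phi \is a fin_num.
  rewrite ge0_fin_numE; first by case: sphi.
  apply: (@le_trans _ _ ((1 + norm2 (0, 0)) ^+ 4 * cabs (phi (0, 0)))%:E).
    by rewrite lee_fin mulr_ge0 ?cabs_ge0// exprn_ge0// addr_ge0// sqrtr_ge0.
  by apply: ereal_sup_ubound; exists [::], (0, 0).
rewrite -[X in (_ <= _ * X)%E]fineK// -EFinM lee_fin.
rewrite (_ : _ * fine _ = 2 * (M * fine (schwartz_norm 4 phi)) * decay2_mass R);
  last by ring.
apply: cabs_cintegral_le; first by case: dphi.
move=> x; rewrite ComplexField.Normc.normcM -mulrA; apply: ler_pM => //.
- exact: cabs_ge0.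
- exact: cabs_ge0.
- exact: schwartz_le_decay2.
Qed.

(** Only the indices 1 and 2 contribute, and the two pieces add up to [P] by [trigpoly_split]. *)
Lemma csumZ_trigpoly (b : bool) (phi : R * R -> R[i]) : schwartz phi ->
  csumZ (fun n => distr_partial b (distr_of (distr_conv (distr_of P) (W n))) phi)
        (distr_partial b (distr_of P) phi).
Proof.
move=> /(schwartz_partial b)/schwartz_decaying dphi.
have convE n : distr_conv (distr_of P) (W n) = trigpoly (wcoef n) xi.
  by apply/funext => x; exact: distr_conv_trigpoly.
pose a n := distr_partial b (distr_of (distr_conv (distr_of P) (W n))) phi.
have a0 n : n != 1 -> n != 2 -> a n = 0.
  move=> n1 n2; rewrite /a /distr_partial convE wcoef_eq0// /distr_of.
  by under eq_fun do rewrite mul0r; rewrite cintegral0 oppr0.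
have aS : distr_partial b (distr_of P) phi = a 1 + a 2.
  rewrite /a /distr_partial !convE -opprD -cintegralD.
  - congr (- cintegral _); apply/funext => x.
    by rewrite trigpoly_split mulrDl.
  - by apply: cboundedM_decaying => //; exact: cbounded_trigpoly.
  - by apply: cboundedM_decaying => //; exact: cbounded_trigpoly.
by rewrite aS; exact: csumZ_two.
Qed.

Lemma besov_normE :
  besov_norm W (distr_of P) =
  (2%:E * Lnorm (leb2 R) +oo (fun x => (cabs (trigpoly (wcoef 1) xi x))%:E) +
   4%:E * Lnorm (leb2 R) +oo (fun x => (cabs (trigpoly (wcoef 2) xi x))%:E))%E.
Proof.
have convE n : distr_conv (distr_of P) (W n) = trigpoly (wcoef n) xi.
  by apply/funext => x; exact: distr_conv_trigpoly.
rewrite /besov_norm; set t := fun n : int => _.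
have t0 n : (0 <= t n)%E.
  by rewrite /t mule_ge0 ?Lnorm_ge0// lee_fin exprz_ge0.
have tE n : n != 1 -> n != 2 -> t n = 0%E.
  move=> n1 n2; rewrite /t convE wcoef_eq0//.
  rewrite (_ : (fun _ => _) = cst 0%E); last first.
    by apply/funext => x; rewrite ComplexField.Normc.normc0.
  by rewrite Lnorm0 ?mule0.
rewrite (esumID [set 1; 2]) ?setTI; last by move=> n _; exact: t0.
rewrite [X in (_ + X)%E]esum1 ?adde0; last first.
  move=> n nn; apply: tE; apply/eqP => nE; apply: nn; [left|right]; exact: nE.
rewrite esum_fset; [|by []|by move=> n _; exact: t0].
rewrite (@fsbigU0 _ _ _ _ [set 1] [set 2]); [|by []|by []|by move=> n [-> /eqP]].
rewrite !fsbig_set1 /t !convE expr1z (_ : 2 ^ 2 = 4)//.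
by rewrite -exprnP; lra.
Qed.

End besov_norm_of_trigonometric_polynomials.

(** * Normalisation in the Besov norm *)

Section besov_normalization.
Variables (R : realType) (w : R -> R) (W : int -> R * R -> R[i]).
Hypotheses (hw : besov_window w) (hW : besov_kernels w W).

Lemma ccontinuous_sub2 (x : R * R) (g : R * R -> R[i]) : ccontinuous g ->
  ccontinuous (fun y => g (x - y)).
Proof.
have cB : continuous (fun y : R * R => x - y).
  by move=> y; apply: cvgB; [exact: cvg_cst|exact: cvg_id].
move=> [g1 g2]; split => y.
  exact: (continuous_comp (cB y) (g1 _)).
exact: (continuous_comp (cB y) (g2 _)).
Qed.

Lemma measurable_cabs (g : R * R -> R[i]) : ccontinuous g ->
  measurable_fun setT
    ((fun x => cabs (g x)) : measurableTypeR R * measurableTypeR R -> R).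
Proof.
move=> [g1 g2]; apply: continuous_measurable2 => x.
have -> : (fun x => cabs (g x)) = (fun t : R => Num.sqrt t) \o
    (fun x => complex.Re (g x) ^+ 2 + complex.Im (g x) ^+ 2).
  by apply/funext => y /=; case: (g y).
apply: continuous_comp; last exact: sqrt_continuous.
by apply: cvgD; apply: cvgM; [exact: g1|exact: g1|exact: g2|exact: g2].
Qed.

Lemma Lnormy_le (g : R * R -> R[i]) (C : R) : (forall x, cabs (g x) <= C) ->
  (Lnorm (leb2 R) +oo (fun x => (cabs (g x))%:E) <= C%:E)%E.
Proof.
(* The norm is an essential supremum if the space has positive measure and 0 otherwise; the bound is
   checked in both cases. *)
move=> gC; rewrite unlock; case: ifP => _.
  by apply/ess_supP/nearW => x /=; rewrite lee_fin ger0_norm ?cabs_ge0.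
by rewrite lee_fin; exact: le_trans (cabs_ge0 _) (gC (0, 0)).
Qed.

Lemma LnormyZ (g : R * R -> R[i]) (a : R) : 0 < a ->
  (Lnorm (leb2 R) +oo (fun x => (cabs (a%:C * g x))%:E) =
   a%:E * Lnorm (leb2 R) +oo (fun x => (cabs (g x))%:E))%E.
Proof.
move=> a0; rewrite unlock; case: ifP => _; last by rewrite mule0.
rewrite -ess_sup_pZl//; congr ess_sup; apply/funext => x /=.
rewrite ComplexField.Normc.normcM /= expr0n addr0 sqrtr_sqr !normrM normr_id.
by rewrite EFinM (gtr0_norm a0).
Qed.

(** Depends on the kernels alone. The outer factors 2 and 4 are the weights [2^n] of the two nonzero
    pieces; the brackets bound [f * W_n] for [|f| <= 1]. *)
Definition besov_bound : R :=
  2 * (2 * fine (schwartz_norm 4 (W 1)) * decay2_mass R) +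
  4 * (2 * fine (schwartz_norm 4 (W 2)) * decay2_mass R).

Section fixed_polynomial.
Variables (I : finType) (c : I -> R[i]) (xi : I -> R * R).
Hypothesis (hxi : forall i, 2 < norm2 (xi i) < 4).
Local Notation P := (trigpoly c xi).

Lemma besov_norm_trigpoly_le : (forall x, cabs (P x) <= 1) ->
  (besov_norm W (distr_of P) <= besov_bound%:E)%E.
Proof.
move=> P1; have B n x : cabs (trigpoly (wcoef w c xi n) xi x) <=
    2 * fine (schwartz_norm 4 (W n)) * decay2_mass R.
  have [sW _] := hW n.
  rewrite -(distr_conv_trigpoly hW) (distr_conv_trigpolyE hW).
  apply: cabs_cintegral_le.
    by apply: ccontinuousM; [case: (cbounded_trigpoly_sub c xi x)|
      case: (schwartz_decaying sW)].
  move=> u; rewrite ComplexField.Normc.normcM.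
  apply: le_trans (schwartz_le_decay2 sW u).
  by rewrite ler_piMl ?cabs_ge0.
rewrite (besov_normE hw hW)//.
rewrite -[besov_bound%:E]/(
  2%:E * (2 * fine (schwartz_norm 4 (W 1)) * decay2_mass R)%:E +
  4%:E * (2 * fine (schwartz_norm 4 (W 2)) * decay2_mass R)%:E)%E.
by apply: leeD; apply: lee_pmul => //; rewrite ?Lnorm_ge0//; exact: Lnormy_le.
Qed.

(* If [P] vanishes almost everywhere then so do all integrals defining [P * W_n],
   which are the trigonometric polynomials that sum up to [P]: hence [P = 0]
   at every point. *)
Lemma besov_norm_trigpoly_eq0 : besov_norm W (distr_of P) = 0%E ->
  forall x, P x = 0.
Proof.
rewrite (besov_normE hw hW)// => /eqP.
rewrite padde_eq0 ?mule_ge0 ?Lnorm_ge0// !mule_eq0 !eqe !pnatr_eq0/=.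
move=> /andP[/eqP L1 /eqP L2].
have mn n : measurable_fun setT (fun x : measurableTypeR R * measurableTypeR R =>
    (cabs (trigpoly (wcoef w c xi n) xi x))%:E).
  by apply/measurable_EFinP; apply: measurable_cabs; exact: ccontinuous_trigpoly.
have aeP : \forall x \ae leb2 R, P x = 0.
  have h1 := Lnorm_eq0_eq0 (mn 1) (ltry 0) L1.
  have h2 := Lnorm_eq0_eq0 (mn 2) (ltry 0) L2.
  apply: filterS2 h1 h2 => x /(_ Logic.I) [] e1 /(_ Logic.I) [] e2.
  rewrite (trigpoly_split hw)//.
  by rewrite (ComplexField.Normc.eq0_normc e1)
    (ComplexField.Normc.eq0_normc e2) addr0.
have conv0 n x : trigpoly (wcoef w c xi n) xi x = 0.
  have [sW _] := hW n.
  rewrite -(distr_conv_trigpoly hW) (distr_conv_trigpolyE hW).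
  rewrite -(distr_conv_trigpolyE hW) /distr_conv /distr_of.
  have cW : ccontinuous (fun y => P y * W n (x - y)).
    apply: ccontinuousM; first exact: ccontinuous_trigpoly.
    by apply: ccontinuous_sub2; case: (schwartz_decaying sW).
  case: cW => cr ci.
  have Z (u : R * R -> R) : continuous u -> (forall y, P y = 0 -> u y = 0) ->
      Rintegral (leb2 R) setT u = 0.
    move=> cu u0.
    have aeu : ae_eq (leb2 R) setT (EFin \o u) (cst 0%E).
      apply: (@filterS _ _ (ae_filter_ringOfSetsType (leb2 R)) _ _ _ aeP) => y Py _.
      by rewrite /= u0.
    rewrite /Rintegral (@ae_eq_integral _ _ _ (leb2 R) _ (cst 0%E))//.
    - by rewrite integral0.
    - by apply/measurable_EFinP; exact: continuous_measurable2.
  by apply: complex_eq; rewrite /cintegral/= Z// => y ->; rewrite mul0r.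
by move=> x; rewrite (trigpoly_split hw)// !conv0 addr0.
Qed.

Lemma besov_norm_trigpolyZ (a : R) : 0 < a ->
  besov_norm W (distr_of (trigpoly (fun i => a%:C * c i) xi)) =
  (a%:E * besov_norm W (distr_of P))%E.
Proof.
move=> a0; rewrite !(besov_normE hw hW)//.
rewrite ge0_muleDr ?mule_ge0 ?Lnorm_ge0//.
have E n :
    (fun x => (cabs (trigpoly (wcoef w (fun i => a%:C * c i) xi n) xi x))%:E) =
    (fun x => (cabs (a%:C * trigpoly (wcoef w c xi n) xi x))%:E).
  apply/funext => x; congr (cabs _)%:E; rewrite /trigpoly big_distrr/=.
  by apply: eq_bigr => i _; rewrite /wcoef !mulrA.
by rewrite !E !LnormyZ// !(muleCA a%:E).
Qed.

Lemma besov_trigpoly : (besov_norm W (distr_of P) < +oo)%E -> besov W P.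
Proof.
move=> Py; split.
- exact: C1_trigpoly.
- move=> phi sphi; apply: decaying_cintegrable; apply: cboundedM_decaying.
    exact: cbounded_trigpoly.
  exact: schwartz_decaying.
- split => //; first exact: tempered_trigpoly.
  by move=> b phi sphi; exact: (csumZ_trigpoly hw hW).
Qed.

End fixed_polynomial.

(** The factor [a] is the reciprocal of the Besov norm, which is positive for a nonzero polynomial
    and at most [besov_bound]. The lower bound on [a] is therefore the same for all polynomials,
    whatever the number of their terms. *)
Lemma besov_normalize : exists2 C : R, 0 < C &
  forall (I : finType) (c : I -> R[i]) (xi : I -> R * R),
    (forall i, 2 < norm2 (xi i) < 4) ->
    (forall x, cabs (trigpoly c xi x) <= 1) ->
    (exists x, trigpoly c xi x != 0) ->
    exists a : R, C <= a /\
      besov W (trigpoly (fun i => a%:C * c i) xi) /\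
      besov_norm W (distr_of (trigpoly (fun i => a%:C * c i) xi)) = 1%E.
Proof.
pose C := `|besov_bound| + 1; have C0 : 0 < C by rewrite ltr_wpDl.
exists C^-1; first by rewrite invr_gt0.
move=> I c xi hxi P1 [x Px].
have := besov_norm_trigpoly_le hxi P1.
have : (0 <= besov_norm W (distr_of (trigpoly c xi)))%E.
  by rewrite (besov_normE hw hW)// adde_ge0// mule_ge0// Lnorm_ge0.
have := besov_norm_trigpolyZ c hxi.
have := besov_norm_trigpoly_eq0 hxi (c := c).
case: (besov_norm W (distr_of (trigpoly c xi))) => [r| |]//.
rewrite !lee_fin => h0 hZ r0 rb.
have {}r0 : 0 < r.
  rewrite lt_neqAle r0 andbT; apply/negP => /eqP r0E.
  by move: Px; rewrite h0 ?eqxx// -r0E.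
have nZ : besov_norm W (distr_of (trigpoly (fun i => r^-1%:C * c i) xi)) = 1%E.
  by rewrite hZ ?invr_gt0// -EFinM mulVf// gt_eqF.
exists r^-1; split; last by split => //; apply: besov_trigpoly => //; rewrite nZ ltry.
rewrite lef_pV2 ?posrE//; apply: (le_trans rb); apply: (le_trans (ler_norm _)).
by rewrite lerDl.
Qed.

End besov_normalization.

(** * Finite rank operators and their functional calculus *)

Section hilbert_space.
Variables (R : realType) (H : lmodType R[i]) (dot : {dot H for Num.conj}).
Local Notation C := R[i].
Local Notation hn := (hnorm dot).

Lemma realC_eq0 (t : R) : (t%:C == 0 :> C) = (t == 0).
Proof. by rewrite eq_complex /= eqxx andbT. Qed.

Lemma dotDl (x y z : H) : dot (x + y) z = dot x z + dot y z.
Proof. exact: linearDl. Qed.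

Lemma dotBl (x y z : H) : dot (x - y) z = dot x z - dot y z.
Proof. exact: linearBl. Qed.

Lemma dotZl (a : C) (x z : H) : dot (a *: x) z = a * dot x z.
Proof. exact: linearZl_LR. Qed.

Lemma dotZr (a : C) (x z : H) : dot x (a *: z) = Num.conj a * dot x z.
Proof. exact: linearZr_LR. Qed.

Lemma dotBr (x y z : H) : dot x (y - z) = dot x y - dot x z.
Proof. exact: linearBr. Qed.

Lemma dot0l (x : H) : dot 0 x = 0.
Proof. exact: linear0l. Qed.

Lemma dotC (x y : H) : dot x y = Num.conj (dot y x).
Proof. by rewrite (hermC dot) expr0 mul1r. Qed.

Lemma dot_suml (I : Type) (r : seq I) (P : pred I) (F : I -> H) (z : H) :
  dot (\sum_(i <- r | P i) F i) z = \sum_(i <- r | P i) dot (F i) z.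
Proof. by apply: (big_morph (dot^~ z)) => [x y|]; rewrite ?dotDl ?dot0l. Qed.

Lemma dot_sumr (I : Type) (r : seq I) (P : pred I) (F : I -> H) (z : H) :
  dot z (\sum_(i <- r | P i) F i) = \sum_(i <- r | P i) dot z (F i).
Proof. exact: linear_sumr. Qed.

Lemma dotxx_ge0 (x : H) : 0 <= dot x x.
Proof. exact: dnorm_ge0. Qed.

Lemma dotxx_eq0 (x : H) : (dot x x == 0) = (x == 0).
Proof. exact: dnorm_eq0. Qed.

Lemma hnorm_sqr (x : H) : (hn x ^+ 2)%:C = dot x x.
Proof.
have := dotxx_ge0 x; rewrite lecE => /andP[/eqP/= im re].
rewrite /hnorm sqr_sqrtr//.
by apply: complex_eq => //=.
Qed.

Lemma hnorm_le (x : H) (M : R) : 0 <= M ->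
  (hn x <= M) = (dot x x <= (M ^+ 2)%:C).
Proof.
move=> M0; rewrite -hnorm_sqr lecR ler_pXn2r// nnegrE//.
exact: sqrtr_ge0.
Qed.

Definition orthonormal_family (N : nat) (e : 'I_N -> H) :=
  forall i j, dot (e i) (e j) = (i == j)%:R.

(** For orthonormal [e], the diagonal matrix [c] on the span of [e], extended by 0 on the orthogonal
    complement. *)
Definition diag_op (N : nat) (e : 'I_N -> H) (c : 'I_N -> C) (x : H) : H :=
  \sum_i (c i * dot x (e i)) *: e i.

Lemma diag_op_is_linear (N : nat) (e : 'I_N -> H) (c : 'I_N -> C) :
  linear (diag_op e c).
Proof.
move=> a x y; rewrite /diag_op scaler_sumr -big_split/=.
apply: eq_bigr => i _; rewrite dotDl dotZl scalerA -scalerDl.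
by congr (_ *: _); ring.
Qed.

HB.instance Definition _ (N : nat) (e : 'I_N -> H) (c : 'I_N -> C) :=
  GRing.isLinear.Build C H H *:%R (diag_op e c) (diag_op_is_linear e c).

Section orthonormal.
Variables (N : nat) (e : 'I_N -> H).
Hypothesis he : orthonormal_family e.

Lemma dot_comb (a : 'I_N -> C) (j : 'I_N) :
  dot (\sum_i a i *: e i) (e j) = a j.
Proof.
rewrite dot_suml (bigD1 j)//= big1 ?addr0 => [|i /negPf ij].
  by rewrite dotZl he eqxx mulr1.
by rewrite dotZl he ij mulr0.
Qed.

Lemma dot_diag_op (c : 'I_N -> C) (x : H) (j : 'I_N) :
  dot (diag_op e c x) (e j) = c j * dot x (e j).
Proof. exact: dot_comb. Qed.

Lemma dot_comb_comb (a : 'I_N -> C) (y : H) :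
  dot y (\sum_i a i *: e i) = \sum_i Num.conj (a i) * dot y (e i).
Proof. by rewrite dot_sumr; apply: eq_bigr => i _; rewrite dotZr. Qed.

Lemma bessel (x : H) : \sum_i `|dot x (e i)| ^+ 2 <= dot x x.
Proof.
pose p := \sum_i dot x (e i) *: e i.
have xp : dot x p = \sum_i `|dot x (e i)| ^+ 2.
  by rewrite dot_comb_comb; apply: eq_bigr => i _; rewrite normCK mulrC.
have pp : dot p p = dot x p.
  by rewrite !dot_comb_comb; apply: eq_bigr => i _; rewrite dot_comb.
have px : dot p x = dot x p.
  rewrite dotC xp rmorph_sum/=; apply: eq_bigr => i _.
  by rewrite conj_Creal// rpredX// ger0_real.
have := dotxx_ge0 (x - p).
by rewrite dotBl !dotBr pp px subrr subr0 xp subr_ge0.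
Qed.

Lemma dot_diag_op_diag_op (c : 'I_N -> C) (x : H) :
  dot (diag_op e c x) (diag_op e c x) = \sum_i `|c i| ^+ 2 * `|dot x (e i)| ^+ 2.
Proof.
rewrite [X in dot _ X]/diag_op dot_comb_comb; apply: eq_bigr => i _.
by rewrite dot_diag_op -exprMn -normrM normCK mulrC.
Qed.

Lemma opnorm_diag_op_le (c : 'I_N -> C) (M : R) : 0 <= M ->
  (forall i, cabs (c i) <= M) -> (opnorm dot (diag_op e c) <= M%:E)%E.
Proof.
move=> M0 cM; apply: ge_ereal_sup => _ [x /= x1 <-].
rewrite lee_fin hnorm_le// dot_diag_op_diag_op.
have {}x1 : dot x x <= 1 by move: x1; rewrite hnorm_le// expr1n.
apply: (@le_trans _ _ ((M ^+ 2)%:C * dot x x)); last first.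
  by rewrite -[leRHS]mulr1 ler_wpM2l// lecR sqr_ge0.
apply: (@le_trans _ _ ((M ^+ 2)%:C * \sum_i `|dot x (e i)| ^+ 2)); last first.
  by rewrite ler_wpM2l ?lecR ?sqr_ge0// bessel.
rewrite mulr_sumr; apply: ler_sum => i _; rewrite ler_wpM2r ?exprn_ge0//.
rewrite -(rmorphXn (@real_complex_def R (Phant R)))/= lecR.
by rewrite ler_pXn2r ?nnegrE ?cabs_ge0.
Qed.

Lemma self_adjoint_diag_op (l : 'I_N -> R) :
  self_adjoint dot (diag_op e (fun i => (l i)%:C)).
Proof.
move=> x y; rewrite dot_suml dot_sumr; apply: eq_bigr => i _.
rewrite dotZl dotZr rmorphM/= -dotC mulrAC; congr (_ * _ * _).
by rewrite [RHS]conjc_real.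
Qed.

Lemma rank_le_diag_op (c : 'I_N -> C) : rank_le (diag_op e c) N.
Proof. by exists e => x; exists (fun i => c i * dot x (e i)). Qed.

Lemma orthonormal_neq0 (i : 'I_N) : e i != 0.
Proof. by rewrite -dotxx_eq0 he eqxx oner_eq0. Qed.

End orthonormal.

Lemma hnorm_ge0 (x : H) : 0 <= hn x.
Proof. exact: sqrtr_ge0. Qed.

(** The Cauchy-Schwarz inequality, obtained as Bessel's inequality for the family consisting of [u]
    alone. *)
Lemma opnorm_ge_dot (T : H -> H) (v u : H) : hn v <= 1 -> dot u u = 1 ->
  ((cabs (dot (T v) u))%:E <= opnorm dot T)%E.
Proof.
move=> v1 u1; apply: (@le_trans _ _ (hn (T v))%:E); last first.
  by apply: ereal_sup_ubound; exists v.
rewrite lee_fin -(@ler_pXn2r _ 2)// ?nnegrE ?cabs_ge0 ?hnorm_ge0//.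
rewrite -lecR hnorm_sqr.
have he : orthonormal_family (fun _ : 'I_1 => u).
  by move=> i j; rewrite u1 !ord1 eqxx.
have := bessel he (T v); rewrite big_ord1.
by rewrite rmorphXn.
Qed.

(** * Point masses of the spectral measure *)

Section spectral.
Variable A : {linear H -> H}.

Lemma eigenvalue_spectrum (l : R) (y : H) : y != 0 -> A y = l%:C *: y ->
  spectrum dot A l.
Proof.
move=> y0 Ay [S [_ SA _]]; move/eqP: y0; apply.
by rewrite -[LHS]SA Ay subrr linear0.
Qed.

Lemma spectral_measure1 (l : R) (x : H) : spectrum dot A l ->
  spectral_measure dot A [set l] x = orth_proj dot [set y | A y = l%:C *: y] x.
Proof.
move=> sl; rewrite /spectral_measure (_ : _ `&` _ = [set l]) ?fsbig_set1//.
by apply/seteqP; split => [t [_ ->]|t ->].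
Qed.

Lemma spectral_measure1N (l : R) (x : H) : ~ spectrum dot A l ->
  spectral_measure dot A [set l] x = 0.
Proof.
move=> sl; rewrite /spectral_measure (_ : _ `&` _ = set0) ?fsbig_set0//.
by apply/seteqP; split => [t [+ tl]|t]//; rewrite tl.
Qed.

(** True for every real [l]: off the spectrum the point mass is 0, and [xget] returns either an
    element of the eigenspace or its default value 0. *)
Lemma spectral_measure_eigen (l : R) (x : H) :
  A (spectral_measure dot A [set l] x) = l%:C *: spectral_measure dot A [set l] x.
Proof.
have [sl|sl] := pselect (spectrum dot A l); last first.
  by rewrite spectral_measure1N// linear0 scaler0.
rewrite spectral_measure1// /orth_proj; case: xgetP => [y _ []//|_].
by rewrite linear0 scaler0.
Qed.

(** A projection [y] of 0 lies in the eigenspace and [0 - y] is orthogonal to it, hence [y] is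
    orthogonal to itself. *)
Lemma spectral_measure0 (l : R) : spectral_measure dot A [set l] 0 = 0.
Proof.
have [sl|sl] := pselect (spectrum dot A l); last by rewrite spectral_measure1N.
rewrite spectral_measure1// /orth_proj; case: xgetP => [y _ [/= Ay]|//].
move=> /(_ _ Ay)/eqP; rewrite sub0r -scaleN1r dotZl mulN1r oppr_eq0 dotxx_eq0.
by move=> /eqP.
Qed.

End spectral.

(** * Spectral measures and functional calculus of diagonal operators *)

Section calculus.
Variables (N : nat) (e : 'I_N -> H) (l : 'I_N -> R).
Hypotheses (he : orthonormal_family e) (l0 : forall i, l i != 0)
  (linj : injective l).
Local Notation A := (diag_op e (fun i => (l i)%:C)).

Lemma diag_op_basis (i : 'I_N) : A (e i) = (l i)%:C *: e i.
Proof.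
rewrite /diag_op (bigD1 i)//= big1 ?addr0 => [|j /negPf ji].
  by rewrite he eqxx mulr1.
by rewrite he eq_sym ji mulr0 scale0r.
Qed.

(** The inner product of [A z] with [e i] is both [t] and [l i] times that of [z]. *)
Lemma eigen_diag_op_dot (t : R) (z : H) (i : 'I_N) : A z = t%:C *: z ->
  t != l i -> dot z (e i) = 0.
Proof.
move=> Az tl; have := dot_diag_op he (fun i => (l i)%:C) z i.
rewrite Az dotZl => /eqP; rewrite -subr_eq0 -mulrBl mulf_eq0 => /orP[|/eqP//].
by rewrite -rmorphB/= (inj_eq (@complexI R)) subr_eq0 (negPf tl).
Qed.

(** The entry 0 accounts for the orthogonal complement of the span. If [t] differs from all [l i],
    then [z] is orthogonal to every [e i], so [t z = A z = 0]. *)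
Lemma eigenvalue_diag_op (t : R) (z : H) : A z = t%:C *: z -> z != 0 ->
  t \in 0 :: [seq l i | i <- enum 'I_N].
Proof.
move=> Az z0; rewrite inE; case: eqVneq => //= t0.
apply/negP => /negP tl; move/eqP: z0; apply.
have : t%:C *: z = 0.
  rewrite -Az; apply: big1 => i _; rewrite (@eigen_diag_op_dot t)// ?mulr0 ?scale0r//.
  by apply: contraNneq tl => ->; apply: map_f; rewrite mem_enum.
by move/eqP; rewrite scaler_eq0 realC_eq0 (negPf t0) => /eqP.
Qed.

Lemma dot_spectral_measure_diag_op (t : R) (y : H) (i : 'I_N) :
  dot (spectral_measure dot A [set t] y) (e i) =
  if t == l i then dot y (e i) else 0.
Proof.
case: eqVneq => [->|tl]; last first.
  by rewrite (@eigen_diag_op_dot t) ?spectral_measure_eigen.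
have Ae := diag_op_basis i.
have ei0 := orthonormal_neq0 he i.
rewrite spectral_measure1; last exact: eigenvalue_spectrum Ae.
rewrite /orth_proj; case: xgetP => [z _ [/= Az]|].
  by move=> /(_ _ Ae)/eqP; rewrite dotBl subr_eq0 => /eqP.
(* The default value of [xget] is excluded by exhibiting a projection: since the [l j] are distinct
   and nonzero, the eigenspace of [l i] is the line through [e i]. *)
move=> /(_ (dot y (e i) *: e i)) []; split => /=.
  by rewrite linearZ/= Ae !scalerA mulrC.
move=> z Az.
have zE : z = dot z (e i) *: e i.
  have li0 : (l i)%:C != 0 :> C by rewrite realC_eq0.
  apply: (scalerI li0); rewrite -Az {1}/diag_op (bigD1 i)//= big1 ?addr0 => [|j ji].
    by rewrite scalerA.
  rewrite (@eigen_diag_op_dot (l i))// ?mulr0 ?scale0r//.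
  by rewrite (inj_eq linj) eq_sym.
by rewrite zE dotZr dotBl dotZl he eqxx mulr1 subrr mulr0.
Qed.

(** For vectors in the span of [e] the projection is explicit even at [t = 0], where the eigenspace
    is orthogonal to the span. It is unique because the difference of two projections both lies in
    the eigenspace and is orthogonal to it. *)
Lemma spectral_measure_diag_op (t : R) (v : 'I_N -> C) :
  spectral_measure dot A [set t] (\sum_i v i *: e i) =
  \sum_i if t == l i then v i *: e i else 0.
Proof.
have [st|st] := pselect (spectrum dot A t); last first.
  rewrite spectral_measure1N// big1// => i _; case: eqP => // tl; exfalso.
  apply: st; rewrite tl.
  exact: eigenvalue_spectrum (orthonormal_neq0 he i) (diag_op_basis i).
rewrite spectral_measure1//; set x := \sum_i v i *: e i; set y := \sum_i _.
have Ay : A y = t%:C *: y.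
  rewrite linear_sum scaler_sumr; apply: eq_bigr => i _.
  case: eqP => [->|_]; last by rewrite linear0 scaler0.
  by rewrite linearZ/= diag_op_basis !scalerA mulrC.
have xy z : A z = t%:C *: z -> dot (x - y) z = 0.
  move=> Az; rewrite /x /y -sumrB dot_suml big1// => i _.
  case: eqVneq => [_|tl]; first by rewrite subrr dot0l.
  by rewrite subr0 dotZl dotC (eigen_diag_op_dot Az tl) conjC0 mulr0.
apply: xget_unique => [|y' [/= Ay' xy']]; first by split.
apply/eqP; rewrite -subr_eq0 -dotxx_eq0.
have Az : A (y' - y) = t%:C *: (y' - y) by rewrite linearB/= Ay Ay' scalerBr.
have {1}-> : y' - y = (x - y) - (x - y').
  by rewrite [in RHS]opprD opprK addrACA subrr add0r addrC.
by rewrite dotBl xy// xy'// subrr.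
Qed.

End calculus.

(* Testing against [e i] selects the eigenvalue [l i] of the first operator, and
   the span of [h] is orthogonal to the kernel of the second one: the eigenvalue
   0 that both operators have in infinite dimension never contributes. *)
Lemma dot_fun_calc (N M : nat) (e : 'I_N -> H) (h : 'I_M -> H)
    (l : 'I_N -> R) (m : 'I_M -> R) (f : R * R -> C) (v : 'I_M -> C) (i : 'I_N) :
  orthonormal_family e -> (forall i, l i != 0) -> injective l ->
  orthonormal_family h -> (forall k, m k != 0) -> injective m ->
  dot (fun_calc dot f (diag_op e (fun i => (l i)%:C))
        (diag_op h (fun k => (m k)%:C)) (\sum_k v k *: h k)) (e i) =
  \sum_k f (l i, m k) * (v k * dot (h k) (e i)).
Proof.
move=> he l0 linj hh m0 minj.
pose A : {linear H -> H} := diag_op e (fun i => (l i)%:C).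
pose B : {linear H -> H} := diag_op h (fun k => (m k)%:C).
set x := \sum_k _.
pose D := spectrum dot A `*` spectrum dot B.
pose F lm := f lm *: spectral_measure dot A [set lm.1]
              (spectral_measure dot B [set lm.2] x).
have sB s : spectral_measure dot B [set s] x =
    \sum_k if s == m k then v k *: h k else 0.
  exact: spectral_measure_diag_op.
have sB0 s : (forall k, s != m k) -> spectral_measure dot B [set s] x = 0.
  by move=> sm; rewrite sB big1// => k _; rewrite (negPf (sm k)).
have FE t s : dot (F (t, s)) (e i) = if t == l i then
    f (t, s) * dot (spectral_measure dot B [set s] x) (e i) else 0.
  rewrite /F /= dotZl dot_spectral_measure_diag_op//.
  by case: ifP; rewrite ?mulr0.
(* [r] lists the pairs that may contribute to the vector-valued sum, with 0 still a candidate for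
   the first operator. Once the sum over [D] is finite over [r], the inner product with [e i] can be
   moved inside, and only the pairs of [r'] survive it. *)
pose r := [seq lm <- [seq (t, s) | t <- undup (0 :: [seq l i | i <- enum 'I_N]),
                                   s <- [seq m k | k <- enum 'I_M]] | lm \in D].
pose r' := [seq (l i, m k) | k <- enum 'I_M].
have ur : uniq r.
  apply: filter_uniq; apply: allpairs_uniq; first exact: undup_uniq.
    by rewrite (map_inj_uniq minj) enum_uniq.
  by move=> [? ?] [? ?].
have ur' : uniq r' by rewrite map_inj_uniq; [exact: enum_uniq|move=> a b [/minj]].
have rD : [set` r] `<=` D by move=> lm; rewrite /= mem_filter => /andP[/set_mem].
have r'D : [set` r'] `<=` D.
  move=> _ /mapP[k _ ->]; split => /=.
    apply: (@eigenvalue_spectrum A _ _ (orthonormal_neq0 he i)).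
    exact: diag_op_basis.
  apply: (@eigenvalue_spectrum B _ _ (orthonormal_neq0 hh k)).
  exact: diag_op_basis.
have F0 lm : D lm -> lm \notin r -> F lm = 0.
  case: lm => t s Dts; rewrite /r mem_filter mem_set// andTb => tsr.
  have [E|z0] := eqVneq (spectral_measure dot A [set t]
      (spectral_measure dot B [set s] x)) 0; first by rewrite /F /= E scaler0.
  exfalso; move/negP: tsr; apply; apply: allpairs_f.
    rewrite mem_undup.
    exact: (eigenvalue_diag_op he (spectral_measure_eigen A _ _) z0).
  have [[k /eqP ->]|sm] := pselect (exists k, s == m k).
    by apply: map_f; rewrite mem_enum.
  exfalso; move/eqP: z0; apply; rewrite sB0 ?spectral_measure0// => k.
  by apply/negP => sk; apply: sm; exists k.
rewrite -[fun_calc _ _ _ _ _]/(\sum_(lm \in D) F lm) (fsbigE r)//= dot_suml.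
rewrite -(@fsbigE _ _ _ _ D r (fun lm => dot (F lm) (e i)))//; last first.
  by move=> lm Dlm lmr; rewrite F0// dot0l.
rewrite (fsbigE r')//; last first.
  move=> [t s] Dts tsr; rewrite FE; case: eqP => // tl; rewrite sB0 ?dot0l ?mulr0// => k.
  by apply: contra tsr => /eqP ->; rewrite tl; apply: map_f; rewrite mem_enum.
rewrite big_map big_mkcond/= big_enum/=; apply: eq_bigr => k _.
rewrite mem_set; last by apply: r'D; apply: map_f; rewrite mem_enum.
rewrite FE eqxx sB (bigD1 k)//= eqxx big1 ?addr0 ?dotZl// => k' /negPf kk'.
by rewrite (inj_eq minj) eq_sym kk'.
Qed.

End hilbert_space.

(** * Orthonormal families of any length *)

Section orthonormal_existence.
Variables (R : realType) (H : lmodType R[i]) (dot : {dot H for Num.conj}).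
Local Notation C := R[i].
Local Notation hn := (hnorm dot).

(** Gram-Schmidt: infinite dimension supplies a vector outside the span of the first [N], whose
    component orthogonal to them is nonzero and can be normalised. *)
Lemma exists_orthonormal (N : nat) : infinite_dim H ->
  exists e : 'I_N -> H, orthonormal_family dot e.
Proof.
move=> infH; elim: N => [|N [e he]]; first by exists (fun=> 0) => -[].
have [x xe] := infH N e.
pose y := x - \sum_i dot x (e i) *: e i.
have y0 : y != 0.
  apply/eqP => /eqP; rewrite subr_eq0 => /eqP xE; apply: xe.
  by exists (fun i => dot x (e i)).
have ye i : dot y (e i) = 0 by rewrite dotBl dot_comb// subrr.
have hy : 0 < hn y.
  rewrite lt_neqAle hnorm_ge0 andbT eq_sym -sqrf_eq0 -realC_eq0 hnorm_sqr.
  by rewrite dotxx_eq0.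
pose u := (hn y)^-1%:C *: y.
have uu : dot u u = 1.
  have E : (hn y)^-1 * ((hn y)^-1 * hn y ^+ 2) = 1 by field; rewrite gt_eqF.
  by rewrite dotZl dotZr [Num.conj _]conjc_real -hnorm_sqr -!rmorphM/= E.
have ue i : dot u (e i) = 0 by rewrite dotZl ye mulr0.
exists (fun i : 'I_N.+1 => if unlift ord_max i is Some j then e j else u) => i j.
case: unliftP => [i' ->|->]; case: unliftP => [j' ->|->].
- by rewrite he (inj_eq lift_inj).
- by rewrite dotC ue conjC0 eq_sym (negPf (neq_lift _ _)).
- by rewrite ue (negPf (neq_lift _ _)).
- by rewrite uu eqxx.
Qed.

End orthonormal_existence.

(** * Singular values and Schatten norms *)

Section schatten.
Variables (R : realType) (H : lmodType R[i]) (dot : {dot H for Num.conj}).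
Local Notation C := R[i].

(** The spanning family is padded with zero vectors and the coefficients with zeros. *)
Lemma rank_le_widen (T : H -> H) (m n : nat) : (m <= n)%N ->
  rank_le T m -> rank_le T n.
Proof.
move=> mn [e Te].
pose ext (V : nmodType) (g : 'I_m -> V) (k : nat) : V := oapp g 0 (insub k).
have extE (V : nmodType) (g : 'I_m -> V) (i : 'I_m) : ext V g i = g i.
  by rewrite /ext valK.
exists (fun i : 'I_n => ext H e i) => x; have [c ->] := Te x.
exists (fun i : 'I_n => ext C c i).
transitivity (\sum_(i < m) ext C c i *: ext H e i).
  by apply: eq_bigr => i _; rewrite !extE.
rewrite (big_ord_widen n (fun k => ext C c k *: ext H e k) mn) big_mkcond.
apply: eq_bigr => i _; case: ifPn => // im.
by rewrite /ext insubN// scale0r.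
Qed.

Lemma opnorm_ge0 (T : H -> H) : (0 <= opnorm dot T)%E.
Proof.
apply: (@le_trans _ _ (hnorm dot (T 0))%:E); first by rewrite lee_fin hnorm_ge0.
by apply: ereal_sup_ubound; exists 0 => //=; rewrite hnorm_le// dot0l lecR.
Qed.

Lemma singular_value_ge0 (T : H -> H) (j : nat) : (0 <= singular_value dot T j)%E.
Proof. by apply: le_ereal_inf_tmp => _ [K _ <-]; exact: opnorm_ge0. Qed.

Lemma opnorm_le_singular_value0 (T : H -> H) :
  (opnorm dot T <= singular_value dot T 0)%E.
Proof.
apply: le_ereal_inf_tmp => _ [K [_ [e Ke]] <-].
rewrite (_ : (fun x => T x - K x) = T)//; apply/funext => x.
by have [c ->] := Ke x; rewrite big_ord0 subr0.
Qed.

(** The operator norm is at most the singular value [s_0], whose [p]-th power is the first term of a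
    series of nonnegative terms. *)
Lemma opnorm_le_schatten (p : R) (T : H -> H) : 0 < p ->
  (opnorm dot T <= schatten_norm dot p T)%E.
Proof.
move=> p0; apply: (le_trans (opnorm_le_singular_value0 T)).
rewrite -[leLHS]poweRe1 ?singular_value_ge0// -(@divff _ p) ?gt_eqF// poweRrM.
apply: gt0_ler_poweR; rewrite ?invr_ge0 ?(ltW p0)// ?in_itv/= ?leey ?andbT ?poweR_ge0//.
  by apply: nneseries_ge0 => j _ _; exact: poweR_ge0.
have := @nneseries_lim_ge R (fun j => singular_value dot T j `^ p)%E xpredT 0%N 1%N.
rewrite big_nat1.
by apply => j _ _; exact: poweR_ge0.
Qed.

(** Every singular value is at most the operator norm, and those from index [N] on vanish because
    the operator, being of rank at most [N], approximates itself. *)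
Lemma schatten_diag_op_le (p : R) (N : nat) (e : 'I_N -> H) (c : 'I_N -> C) (M : R) :
  0 < p -> 0 <= M -> orthonormal_family dot e -> (forall i, cabs (c i) <= M) ->
  (schatten_norm dot p (diag_op dot e c) <= (N%:R `^ p^-1 * M)%:E)%E.
Proof.
move=> p0 M0 he cM; set T := diag_op dot e c.
have opT : (opnorm dot T <= M%:E)%E by exact: opnorm_diag_op_le.
have op0 : opnorm dot (fun=> 0) = 0%E.
  apply/eqP; rewrite eq_le opnorm_ge0 andbT; apply: ge_ereal_sup => _ [x _ <-].
  by rewrite lee_fin hnorm_le// dot0l lecR sqr_ge0.
have sM j : (singular_value dot T j <= M%:E)%E.
  apply: le_trans opT; apply: ereal_inf_lbound.
  (* The zero operator, written as a diagonal one, is an admissible approximant for every [j]. *)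
  exists (diag_op dot e (fun=> 0)); last first.
    congr opnorm; apply/funext => x.
    rewrite /diag_op [X in _ - X]big1 ?subr0// => i _.
    by rewrite mul0r scale0r.
  split.
    apply: (@le_lt_trans _ _ 0%:E); last exact: ltry.
    by apply: opnorm_diag_op_le => // i; rewrite ComplexField.Normc.normc0.
  apply: (@rank_le_widen _ 0) => //; exists (fun=> 0) => x; exists (fun=> 0).
  by rewrite big_ord0; apply: big1 => i _; rewrite mul0r scale0r.
have s0 j : (N <= j)%N -> singular_value dot T j = 0%E.
  move=> Nj; apply/eqP; rewrite eq_le singular_value_ge0 andbT -op0.
  apply: ereal_inf_lbound; exists T.
    split; first exact: le_lt_trans opT (ltry _).
    by apply: rank_le_widen Nj _; exact: rank_le_diag_op.
  by congr opnorm; apply/funext => x; rewrite subrr.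
have sE : (\sum_(0 <= j <oo) (singular_value dot T j `^ p) <= (N%:R * M `^ p)%:E)%E.
  rewrite (nneseries_split _ N); last by move=> k _; exact: poweR_ge0.
  rewrite add0n [X in (_ + X)%E]eseries0 ?adde0; last first.
    by move=> i Ni _; rewrite s0// poweR0r// gt_eqF.
  apply: (@le_trans _ _ (\sum_(0 <= k < N) (M `^ p)%:E)%E).
    apply: lee_sum => k _; rewrite -poweR_EFin.
    apply: gt0_ler_poweR; rewrite ?(ltW p0)// ?in_itv/= ?leey ?andbT//.
    exact: singular_value_ge0.
  by rewrite sumEFin lee_fin big_const_nat subn0 iter_addr_0 mulr_natl.
rewrite /schatten_norm.
have -> : (N%:R `^ p^-1 * M)%:E = ((N%:R * M `^ p)%:E `^ p^-1)%E.
  rewrite poweR_EFin powRM ?powR_ge0// -powRrM divff ?gt_eqF//.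
  by rewrite powRr1.
apply: gt0_ler_poweR; rewrite ?invr_ge0 ?(ltW p0)// ?in_itv/= ?andbT ?leey ?andbT//.
  by apply: nneseries_ge0 => j _ _; exact: poweR_ge0.
by rewrite lee_fin mulr_ge0// powR_ge0.
Qed.

End schatten.

(** * The interpolating polynomial *)

Section roots_of_unity.
Variable R : realType.
Implicit Types (s t : R).

Lemma cisN t : cis (- t) = Num.conj (cis t).
Proof. by rewrite /cis cosN sinN. Qed.

Lemma cisMn t (n : nat) : cis (n%:R * t) = cis t ^+ n.
Proof.
elim: n => [|n IH]; first by rewrite mul0r cis0 expr0.
by rewrite exprS -IH -cisD -natr1; congr cis; ring.
Qed.

Lemma cis_2pi (n : nat) : cis (2 * pi * n%:R) = 1 :> R[i].
Proof.
rewrite mulrC cisMn (_ : cis (2 * pi) = 1) ?expr1n//.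
by rewrite /cis mulr_natl cos2pi sin2pi.
Qed.

(** Half-angle formula: the real part is [1 - 2 sin^2 t] with [0 < t < pi]. *)
Lemma cis_2pi_div_neq1 (N m : nat) : (0 < m < N)%N ->
  cis (2 * pi * m%:R / N%:R) != 1 :> R[i].
Proof.
move=> /andP[m0 mN]; apply/eqP => /(congr1 (@complex.Re R))/= c1.
have n0 : (0 < N)%N by exact: leq_trans mN.
have N0 : (0 : R) < N%:R by rewrite ltr0n.
pose t : R := pi * m%:R / N%:R.
have : 0 < sin t.
  apply: sin_gt0_pi; rewrite /t divr_gt0 ?mulr_gt0 ?pi_gt0 ?ltr0n//=.
  by rewrite ltr_pdivrMr// ltr_pM2l ?pi_gt0// ltr_nat.
move: c1; rewrite (_ : 2 * pi * m%:R / N%:R = t *+ 2); last first.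
  by rewrite /t -mulr_natl; ring.
rewrite cos_mulr2n cos2sin2 mulr2n => c1 st.
have : sin t ^+ 2 = 0 by lra.
by move/eqP; rewrite sqrf_eq0 gt_eqF.
Qed.

(** Orthogonality of characters: off the diagonal the sum is geometric, over the powers of an [N]-th
    root of unity other than 1. Complex conjugation exchanges [a] and [b], so [a - b] may be taken
    to be a natural number. *)
Lemma sum_cis (N a b : nat) : (a < N)%N -> (b < N)%N ->
  \sum_(k < N) cis (2 * pi * (a%:R - b%:R) * k.+1%:R / N%:R) =
  (N * (a == b))%:R :> R[i].
Proof.
wlog ab : a b / (b <= a)%N => [WL aN bN|].
  have [ba|/ltnW ab] := leqP b a; first exact: WL.
  have := WL _ _ ab bN aN => /(congr1 Num.conj).
  rewrite rmorph_nat rmorph_sum/= eq_sym => <-; apply: eq_bigr => k _.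
  by rewrite -cisN; congr cis; ring.
move=> aN bN; have [->|nab] := eqVneq a b.
  rewrite muln1 (eq_bigr (fun=> 1)) ?sumr_const ?card_ord// => k _.
  by rewrite subrr mulr0 !mul0r cis0.
have N0 : (N%:R : R) != 0 by rewrite pnatr_eq0 -lt0n (leq_ltn_trans _ aN).
rewrite muln0 -natrB//; set m := (a - b)%N.
have m0 : (0 < m < N)%N.
  by rewrite subn_gt0 ltn_neqAle eq_sym nab ab/= (leq_ltn_trans (leq_subr _ _)).
pose z : R[i] := cis (2 * pi * m%:R / N%:R).
have z1 : z != 1 by exact: cis_2pi_div_neq1.
have zN : z ^+ N = 1.
  by rewrite -cisMn (_ : _ * _ = 2 * pi * m%:R) ?cis_2pi//; field.
rewrite (eq_bigr (fun k : 'I_N => z * z ^+ k)); last first.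
  by move=> k _; rewrite -exprS -cisMn; congr cis; ring.
rewrite -mulr_sumr; apply/eqP; rewrite mulf_eq0; apply/orP; right.
have := subrX1 z N; rewrite zN subrr => /esym/eqP.
by rewrite mulf_eq0 subr_eq0 (negPf z1).
Qed.

Section fejer.
Variable N : nat.
Hypothesis N0 : (0 < N)%N.
Let NR0 : (N%:R : R) != 0. Proof. by rewrite pnatr_eq0 -lt0n. Qed.

(** The Fejer kernel of period [2 pi], scaled to have value 1 at 0. It is evaluated at
    [s = x / (2 N)], which gives period [4 pi N] in [x]. *)
Definition fejer s : R := (N%:R ^- 2) * cabs (\sum_(a < N) cis (a%:R * s)) ^+ 2.

Lemma fejer_ge0 s : 0 <= fejer s.
Proof. by rewrite mulr_ge0 ?invr_ge0 ?exprn_ge0 ?cabs_ge0. Qed.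

Lemma cabs_sqr (z : R[i]) : (cabs z ^+ 2)%:C = z * Num.conj z.
Proof. by rewrite -normCK -[`|z|]/((cabs z)%:C) rmorphXn. Qed.

Lemma fejerE s : (fejer s)%:C =
  \sum_(a < N) \sum_(b < N) (N%:R ^- 2)%:C * cis ((a%:R - b%:R) * s).
Proof.
rewrite /fejer rmorphM/= cabs_sqr rmorph_sum/= big_distrlr/= mulr_sumr.
apply: eq_bigr => a _; rewrite mulr_sumr; apply: eq_bigr => b _.
by rewrite -cisN -cisD; congr (_ * cis _); ring.
Qed.

(* Numbered from 1, so that 0 is not a node. *)
Definition node (j : nat) : R := 4 * pi * j.+1%:R.

(* Parseval for the discrete Fourier transform. *)
Lemma fejer_partition (x : R) :
  \sum_(j < N) fejer ((x - node j) / (2 * N%:R)) = 1.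
Proof.
apply: (@complexI R); rewrite rmorph_sum/=.
under eq_bigr do rewrite fejerE.
rewrite exchange_big/=; under eq_bigr do rewrite exchange_big/=.
(* The nodes are [4 pi] apart, so after division by [2 N] they advance by [2 pi / N], and summing
   over [j] leaves only [a = b] by [sum_cis]. *)
transitivity (\sum_(a < N) \sum_(b < N) (N%:R ^- 2)%:C *
   (cis ((a%:R - b%:R) * x / (2 * N%:R)) * (N * (b == a))%:R) : R[i]).
  apply: eq_bigr => a _; apply: eq_bigr => b _.
  rewrite -mulr_sumr; congr (_ * _); rewrite -(sum_cis (ltn_ord b) (ltn_ord a)).
  rewrite mulr_sumr; apply: eq_bigr => j _; rewrite -cisD; congr cis.
  by rewrite /node; field.
transitivity (\sum_(a < N) (N%:R^-1)%:C : R[i]).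
  apply: eq_bigr => a _; rewrite (bigD1 a)//= big1 ?addr0 => [|b /negPf ba].
    rewrite eqxx muln1 subrr !mul0r cis0 mul1r.
    rewrite -(rmorph_nat (real_complex R) N) -rmorphM/=.
    by congr (_%:C); field.
  by rewrite ba muln0 !mulr0.
rewrite sumr_const card_ord -rmorphMn/= (_ : N%:R^-1 *+ N = 1)//.
by rewrite -[LHS]mulr_natr mulVf.
Qed.

Lemma fejer0 : fejer 0 = 1.
Proof.
apply: (@complexI R); rewrite /fejer rmorphM/= cabs_sqr.
rewrite (eq_bigr (fun=> 1)); last by move=> a _; rewrite mulr0 cis0.
rewrite sumr_const card_ord rmorph_nat -(rmorph_nat (real_complex R) N) -!rmorphM/=.
by congr (_%:C); field.
Qed.

End fejer.
End roots_of_unity.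
Arguments node {R} j.

(** * The polynomial and its pairing with the discrete Fourier transform *)

Section interpolating_polynomial.
Variables (R : realType) (N : nat).
Hypothesis N0 : (0 < N)%N.
Let NR0 : (N%:R : R) != 0. Proof. by rewrite pnatr_eq0 -lt0n. Qed.
Let NRgt0 : 0 < (N%:R : R). Proof. by rewrite ltr0n. Qed.
Local Notation I := ('I_N * ('I_N * 'I_N))%type.
Local Notation fejer := (@fejer R N).

(* The polynomial of [interpE], expanded into waves. The factor [cis (3 * x)]
   moves all frequencies into the annulus [2 < |xi| < 4], and makes the first
   derivative of the values at the nodes nonzero. *)
Definition interp_coef (p : I) : R[i] :=
  (N%:R ^- 2)%:C * cis (- ((p.2.1%:R - p.2.2%:R) * node p.1 / (2 * N%:R))).

Definition interp_freq (p : I) : R * R :=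
  (3 + (p.2.1%:R - p.2.2%:R) / (2 * N%:R), - (p.1.+1%:R / (2 * N%:R))).

Definition interp : R * R -> R[i] := trigpoly interp_coef interp_freq.

Lemma interpE (x y : R) : interp (x, y) = cis (3 * x) *
  \sum_(j < N) (fejer ((x - node j) / (2 * N%:R)))%:C *
     cis (- (j.+1%:R * y / (2 * N%:R))).
Proof.
rewrite /interp /trigpoly.
rewrite -(pair_big xpredT xpredT (fun j ab => interp_coef (j, ab) *
  wave (interp_freq (j, ab)) (x, y)))/=.
rewrite mulr_sumr; apply: eq_bigr => j _.
rewrite -(pair_big xpredT xpredT (fun a b => interp_coef (j, (a, b)) *
  wave (interp_freq (j, (a, b))) (x, y)))/=.
rewrite fejerE mulrCA mulr_suml; apply: eq_bigr => a _.
rewrite mulr_suml; apply: eq_bigr => b _.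
rewrite /interp_coef /wave /= -!mulrA; congr (_ * _).
rewrite -!cisD; congr cis; rewrite /node; field.
exact: NR0.
Qed.

Lemma cabs_interp_le1 (z : R * R) : cabs (interp z) <= 1.
Proof.
case: z => x y; rewrite interpE ComplexField.Normc.normcM cabs_cis mul1r.
apply: (le_trans (cabs_sum_le _ _)).
rewrite -[leRHS](fejer_partition N0 x); apply: ler_sum => j _.
rewrite ComplexField.Normc.normcM cabs_cis mulr1 cabs_real.
by rewrite ger0_norm ?fejer_ge0.
Qed.

(** The first component lies between [5/2] and [7/2] and the second is at most [1/2] in modulus, so
    the squared norm is between [25/4] and [25/2]. *)
Lemma norm2_interp_freq (p : I) : 2 < norm2 (interp_freq p) < 4.
Proof.
case: p => j [a b]; rewrite /norm2 /interp_freq /=.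
set u := (_ - _) / _; set v := _ / _.
have N2 : 0 < 2 * N%:R :> R by rewrite mulr_gt0.
have u2 : -(1/2) < u < 1/2.
  have aN : a%:R < N%:R :> R by rewrite ltr_nat.
  have bN : b%:R < N%:R :> R by rewrite ltr_nat.
  have a0 : 0 <= a%:R :> R by [].
  have b0 : 0 <= b%:R :> R by [].
  by rewrite /u ltr_pdivlMr// ltr_pdivrMr//; apply/andP; split; lra.
have v2 : 0 <= v <= 1/2.
  have jN : j.+1%:R <= N%:R :> R by rewrite ler_nat.
  have j0 : 0 <= j.+1%:R :> R by [].
  by rewrite /v ler_pdivlMr// ler_pdivrMr//; apply/andP; split; lra.
case/andP: u2 => u1 u2; case/andP: v2 => v1 v2.
rewrite -{1}(@ger0_norm R 2)// -(@ger0_norm R 4)// -!sqrtr_sqr.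
rewrite !ltr_sqrt ?exprn_gt0//; last by nra.
by apply/andP; split; nra.
Qed.

Lemma cis_node (i : 'I_N) (d : R) : cis (3 * (node i + d)) = cis (3 * d).
Proof.
rewrite mulrDr cisD (_ : 3 * node i = 2 * pi * (6 * i.+1)%:R) ?cis_2pi ?mul1r//.
by rewrite /node natrM; ring.
Qed.

Definition dft (k i : 'I_N) : R[i] := cis (2 * pi * i.+1%:R * k.+1%:R / N%:R).

Lemma sum_dft (i j : 'I_N) :
  \sum_k dft k i * Num.conj (dft k j) = (N * (i == j))%:R.
Proof.
rewrite -(sum_cis R (ltn_ord i) (ltn_ord j)); apply: eq_bigr => k _.
by rewrite -cisN -cisD; congr cis; rewrite -!natr1; ring.
Qed.

Lemma dftC (k i : 'I_N) : dft k i = dft i k.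
Proof. by congr cis; ring. Qed.

(** At [y = node k] the phase of the [j]-th term of [interpE] is the conjugate of [dft k j].
    Summation over [k] therefore selects [j = i], and every [i] contributes the same value. *)
Lemma interp_pairing (d : R) :
  \sum_(i < N) \sum_(k < N) interp (node i + d, node k) * dft k i =
  (N%:R ^+ 2)%:C * (cis (3 * d) * (fejer (d / (2 * N%:R)))%:C).
Proof.
transitivity (\sum_(i < N) N%:R * (cis (3 * d) * (fejer (d / (2 * N%:R)))%:C)).
  apply: eq_bigr => i _.
  under eq_bigr do rewrite interpE cis_node mulr_sumr mulr_suml.
  rewrite exchange_big/=.
  transitivity (\sum_(j < N) cis (3 * d) *
      (fejer ((node i + d - node j) / (2 * N%:R)))%:C * (N * (i == j))%:R).
    apply: eq_bigr => j _; rewrite -sum_dft mulr_sumr; apply: eq_bigr => k _.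
    have -> : cis (- (j.+1%:R * node k / (2 * N%:R))) = Num.conj (dft k j).
      by rewrite -cisN; congr cis; rewrite /node; field.
    by ring.
  rewrite (bigD1 i)//= big1 ?addr0 => [|j /negPf ji]; last first.
    by rewrite eq_sym ji muln0 mulr0.
  by rewrite eqxx muln1 mulrC addrAC subrr add0r.
rewrite sumr_const card_ord -mulrnAl; congr (_ * _).
by rewrite rmorphXn/= rmorph_nat expr2 -[LHS]mulr_natr.
Qed.

(** Otherwise the pairing at [d = 0] would be 0 instead of [N^2]. *)
Lemma interp_neq0 : exists z, interp z != 0.
Proof.
apply: contrapT => /forallNP h.
have := interp_pairing 0.
rewrite mulr0 cis0 mul1r mul0r fejer0// mulr1 big1.
  by move=> /(congr1 (@complex.Re R))/=/esym/eqP; rewrite expf_eq0 (negPf NR0).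
move=> i _; apply: big1 => k _.
by have /negP := h (node i + 0, node k); rewrite negbK => /eqP ->; rewrite mul0r.
Qed.

(* [|r e^(i t) - 1| >= |Im (e^(-i t) (r e^(i t) - 1))| = |sin t|] for real [r]. *)
Lemma interp_pairing_diff (d : R) :
  N%:R ^+ 2 * `|sin (3 * d)| <=
  cabs (\sum_(i < N) \sum_(k < N)
    (interp (node i + d, node k) - interp (node i, node k)) * dft k i).
Proof.
rewrite (_ : \sum_(i < N) _ = (N%:R ^+ 2)%:C *
    (cis (3 * d) * (fejer (d / (2 * N%:R)))%:C - 1)); last first.
  rewrite mulrBr mulr1 -interp_pairing.
  have := interp_pairing 0; rewrite mulr0 cis0 mul1r mul0r fejer0// mulr1 => <-.
  rewrite -sumrB; apply: eq_bigr => i _; rewrite -sumrB; apply: eq_bigr => k _.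
  by rewrite mulrBl addr0.
rewrite ComplexField.Normc.normcM cabs_real [`|N%:R ^+ 2|]ger0_norm ?sqr_ge0//.
rewrite ler_pM2l ?exprn_gt0//.
set r := fejer _.
have := normr_Im (cis (- (3 * d)) * (cis (3 * d) * r%:C - 1)).
rewrite ComplexField.Normc.normcM cabs_cis mul1r; apply: le_trans.
rewrite mulrBr mulrA -cisD addNr cis0 mul1r mulr1 ImD ImN /= sinN.
by rewrite opprK add0r.
Qed.

End interpolating_polynomial.

(** * The counterexample *)

Section counterexample.
Variables (R : realType) (w : R -> R) (W : int -> R * R -> R[i]).
Hypotheses (hw : besov_window w) (hW : besov_kernels w W).
Variables (H : lmodType R[i]) (dot : {dot H for Num.conj}).
Hypothesis hdim : infinite_dim H.
Local Notation C := R[i].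

Section matrices.
Variable N : nat.
Hypothesis N0 : (0 < N)%N.
Variable e : 'I_N -> H.
Hypothesis he : orthonormal_family dot e.

Let s : R := (Num.sqrt N%:R)^-1.
Let NRgt0 : 0 < (N%:R : R). Proof. by rewrite ltr0n. Qed.
Let s0 : 0 < s. Proof. by rewrite invr_gt0 sqrtr_gt0. Qed.
Let ssN : s * s * N%:R = 1.
Proof. by rewrite -invfM -expr2 sqr_sqrtr ?ltW// mulVf ?gt_eqF. Qed.

(* The rescaled discrete Fourier transform of [e]: every [dft_basis k] makes the
   same angle with every [e i]. *)
Definition dft_basis (k : 'I_N) : H := \sum_i (s%:C * dft R k i) *: e i.

Lemma orthonormal_dft_basis : orthonormal_family dot dft_basis.
Proof.
move=> k l; rewrite [X in dot _ X]/dft_basis dot_comb_comb.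
transitivity ((s * s)%:C * \sum_i dft R i k * Num.conj (dft R i l)).
  rewrite mulr_sumr; apply: eq_bigr => i _; rewrite dot_comb//.
  rewrite rmorphM/= [Num.conj s%:C]conjc_real.
  by rewrite rmorphM/= ![dft R _ i]dftC; ring.
rewrite sum_dft// natrM mulrA -(rmorph_nat (real_complex R) N) -rmorphM/= ssN.
by rewrite mul1r.
Qed.

Lemma node_gt0 (i : 'I_N) : 0 < node i :> R.
Proof. by rewrite /node !mulr_gt0 ?pi_gt0// ltr0n. Qed.

Lemma node_inj (i j : 'I_N) : node i = node j :> R -> i = j.
Proof.
have p4 : 4 * pi != 0 :> R by rewrite gt_eqF// mulr_gt0 ?pi_gt0.
by move=> /(mulfI p4)/eqP; rewrite eqr_nat eqSS => /eqP/val_inj.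
Qed.

Lemma opnorm_fun_calc_diff_ge (a d : R) : 0 < a -> 0 <= d ->
  let f z := a%:C * interp N z in
  let B := diag_op dot dft_basis (fun k => (node k)%:C) in
  ((a * Num.sqrt N%:R * `|sin (3 * d)|)%:E <=
   opnorm dot (fun x =>
     fun_calc dot f (diag_op dot e (fun i => (node i)%:C)) B x -
     fun_calc dot f (diag_op dot e (fun i => (node i + d)%:C)) B x)%R)%E.
Proof.
move=> a0 d0 /=; set f := (fun z => a%:C * interp N z).
set B := diag_op dot dft_basis _.
pose v := \sum_k s%:C *: dft_basis k.
pose u := \sum_i s%:C *: e i.
have unit_sum (g : 'I_N -> H) : orthonormal_family dot g ->
    dot (\sum_i s%:C *: g i) (\sum_i s%:C *: g i) = 1.
  move=> hg; rewrite dot_comb_comb.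
  under eq_bigr do rewrite dot_comb// [Num.conj _]conjc_real.
  rewrite sumr_const card_ord -rmorphM/= -rmorphMn/= -mulr_natr ssN.
  by [].
have v1 : hnorm dot v <= 1.
  by rewrite hnorm_le// expr1n unit_sum//; exact: orthonormal_dft_basis.
have u1 : dot u u = 1 by exact: unit_sum.
apply: le_trans (opnorm_ge_dot _ v1 u1).
rewrite lee_fin /u dot_comb_comb.
have fcE (l : 'I_N -> R) i : (forall i, l i != 0) -> injective l ->
    dot (fun_calc dot f (diag_op dot e (fun i => (l i)%:C)) B v) (e i) =
    \sum_(k < N) f (l i, node k) * (s%:C * (s%:C * dft R k i)).
  move=> l0 linj; rewrite dot_fun_calc//.
  - by apply: eq_bigr => k _; rewrite [dot (dft_basis k) _]dot_comb.
  - exact: orthonormal_dft_basis.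
  - by move=> k; rewrite gt_eqF ?node_gt0.
  - exact: node_inj.
(* The three factors [s] normalise [v], [u] and [dft_basis]; the sign reflects that the shifted
   operator is the one subtracted. *)
have -> : \sum_i Num.conj s%:C * dot (
     fun_calc dot f (diag_op dot e (fun i => (node i)%:C)) B v -
     fun_calc dot f (diag_op dot e (fun i => (node i + d)%:C)) B v) (e i) =
   - ((a * s ^+ 3)%:C * \sum_(i < N) \sum_(k < N)
    (interp N (node i + d, node k) - interp N (node i, node k)) * dft R k i).
  rewrite mulr_sumr -[RHS]sumrN; apply: eq_bigr => i _.
  rewrite dotBl fcE; [|by move=> j; rewrite gt_eqF ?node_gt0|exact: node_inj].
  rewrite fcE; [|by move=> j; rewrite gt_eqF// ltr_wpDr ?node_gt0
    |by move=> j k /addIr/node_inj].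
  rewrite [Num.conj _]conjc_real -sumrB !mulr_sumr -[RHS]sumrN; apply: eq_bigr => k _.
  by rewrite /f rmorphM rmorphXn/=; ring.
rewrite normcN ComplexField.Normc.normcM cabs_real [`|a * _|]gtr0_norm;
  last by rewrite mulr_gt0 ?exprn_gt0.
apply: le_trans (_ : a * s ^+ 3 * (N%:R ^+ 2 * `|sin (3 * d)|) <= _).
  rewrite mulrA ler_wpM2r// -mulrA ler_pM2l//.
  have -> : s ^+ 3 * N%:R ^+ 2 = s * N%:R.
    by transitivity (s * s * N%:R * (s * N%:R)); [ring|rewrite ssN mul1r].
  have q0 : Num.sqrt (N%:R : R) != 0 by rewrite gt_eqF ?sqrtr_gt0.
  have -> // : s * N%:R = Num.sqrt N%:R.
  by apply: (mulfI q0); rewrite mulrA mulfV// mul1r -expr2 sqr_sqrtr ?ltW.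
rewrite ler_pM2l; first exact: interp_pairing_diff.
by rewrite mulr_gt0 ?exprn_gt0.
Qed.

End matrices.

(** The constant is that of [besov_normalize], a lower bound on the amplitude [a] that depends on
    neither [N] nor [d]. *)
Lemma besov_perturbation : exists2 c : R, 0 < c &
  forall (N : nat) (d : R), (0 < N)%N -> 0 <= d ->
  exists (f : R * R -> C) (A1 A2 B : {linear H -> H}),
    [/\ besov W f /\ besov_norm W (distr_of f) = 1%E,
        [/\ self_adjoint dot A1, self_adjoint dot A2 & self_adjoint dot B] /\
        [/\ finite_rank A1, finite_rank A2 & finite_rank B],
        forall p, 0 < p ->
          (schatten_norm dot p (fun x => A1 x - A2 x)%R <=
             (N%:R `^ p^-1 * d)%:E)%E &
        ((c * Num.sqrt N%:R * `|sin (3 * d)|)%:E <=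
         opnorm dot (fun x => fun_calc dot f A1 B x - fun_calc dot f A2 B x)%R)%E].
Proof.
have [c c0 hc] := besov_normalize hw hW; exists c => // N d N0 d0.
have [e he] := exists_orthonormal dot N hdim.
have [a [ca [bf nf]]] := hc _ _ _ (@norm2_interp_freq R N N0)
  (@cabs_interp_le1 R N N0) (@interp_neq0 R N N0).
have a0 : 0 < a by exact: lt_le_trans ca.
have fE : trigpoly (fun p => a%:C * interp_coef R p) (@interp_freq R N) =
    fun z => a%:C * interp N z.
  by apply/funext => z; rewrite /interp /trigpoly mulr_sumr;
    apply: eq_bigr => i _; rewrite mulrA.
rewrite fE in bf nf.
have hB := orthonormal_dft_basis N0 he.
(* The difference of the two operators is [- d] times the orthogonal projection onto the span of
   [e]. *)
have AE : (fun x => diag_op dot e (fun i => (node i)%:C) x -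
    diag_op dot e (fun i => (node i + d)%:C) x) = diag_op dot e (fun=> (- d)%:C).
  apply/funext => x; rewrite /diag_op -sumrB; apply: eq_bigr => i _.
  by rewrite -scalerBl -mulrBl -rmorphB/= opprD addNKr.
have cd (i : 'I_N) : cabs (- d)%:C <= d by rewrite cabs_real normrN ger0_norm.
exists (fun z => a%:C * interp N z), (diag_op dot e (fun i => (node i)%:C)),
  (diag_op dot e (fun i => (node i + d)%:C)),
  (diag_op dot (dft_basis e) (fun k => (node k)%:C)); split => //.
- split; split; try exact: self_adjoint_diag_op; by exists N; exact: rank_le_diag_op.
- by move=> p p0; rewrite AE; exact: schatten_diag_op_le.
- apply: le_trans (opnorm_fun_calc_diff_ge N0 he a0 d0).
  by rewrite lee_fin -!mulrA ler_wpM2r// mulr_ge0 ?sqrtr_ge0.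
Qed.

End counterexample.

(** * Choice of the dimension and of the shift *)

Lemma sin_lower_bound (R : realType) :
  exists2 t0 : R, 0 < t0 & forall t, 0 < t < t0 -> t <= 3 * `|sin t|.
Proof.
have [ds dsE] := is_derive_sin (0 : R).
have : (fun h : R => h^-1 *: ((sin \o shift 0) (h *: 1) - sin 0)) @ 0^' --> (1 : R).
  by rewrite -[X in _ --> X](cos0 R) -dsE; exact: ds.
(* Near 0 the quotient [sin t / t] is at least [1/2], so even [t <= 2 sin t]. With the weaker
   constant 3 and [t = 3 d] the bound reads [d <= |sin (3 d)|]. *)
move=> /cvgrPdist_lt/(_ (1/2)) h.
have /h {h} : 0 < 1/2 :> R by lra.
rewrite near_withinE => /nbhs_ballP[t0 /= t00 ht].
exists t0 => // t /andP[t_gt0 tt0].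
have := ht t; rewrite /ball/= sub0r normrN gtr0_norm// => /(_ tt0).
rewrite gt_eqF// => /(_ isT); rewrite sin0 subr0 addr0 [_ *: 1]mulr1 => h.
have : 1/2 <= t^-1 * sin t.
  by move: h; rewrite ltr_norml => /andP[_]; rewrite /GRing.scale/=; lra.
rewrite ler_pdivlMl// => h2; have := ler_norm (sin t); lra.
Qed.

(* [N = (n+1)^(2k)] and [d = (n+1)^(1-k)], where [k] is so large that
   [2k/p <= k - 2]; then [N^(1/p) d <= 1/(n+1)] and [sqrt N d = n+1]. *)
Lemma perturbation_scales (R : realType) (p : R) : 2 < p ->
  exists (N : nat -> nat) (d : nat -> R),
    [/\ forall n, (0 < N n)%N, forall n, 0 <= d n,
       (fun n => (N n)%:R `^ p^-1 * d n) @ \oo --> (0 : R) &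
       (fun n => Num.sqrt (N n)%:R * `|sin (3 * d n)|) @ \oo --> +oo].
Proof.
move=> p2.
have q0 : 0 < 1 - 2 / p.
  by rewrite subr_gt0 ltr_pdivrMr ?mul1r//; lra.
pose k := Num.bound (2 / (1 - 2 / p)).
have kq : 2 <= k%:R * (1 - 2 / p).
  rewrite -ler_pdivrMr//; apply/ltW/archi_boundP.
  by rewrite divr_ge0// ltW.
have k2 : (2 <= k)%N.
  rewrite -(ler_nat R); apply: (le_trans kq); rewrite ler_piMr//.
  by rewrite lerBlDr lerDl divr_ge0//; lra.
have x0 (n : nat) : 0 < n.+1%:R :> R by [].
have dE (n : nat) : n.+1%:R ^- (k - 1) <= n.+1%:R^-1 :> R.
  rewrite lef_pV2 ?posrE ?exprn_gt0// -[leLHS]expr1 ler_weXn2l ?ler1n//.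
  by rewrite ltn_subRL addn0.
exists (fun n => (n.+1 ^ (2 * k))%N), (fun n => n.+1%:R ^- (k - 1)); split.
- by move=> n; rewrite expn_gt0.
- by move=> n; rewrite invr_ge0 exprn_ge0.
- apply: (squeeze_cvgr _ (cvg_cst 0) (@cvg_harmonic R)); apply: nearW => n.
  rewrite mulr_ge0 ?powR_ge0 ?invr_ge0 ?exprn_ge0//=.
  apply: (@le_trans _ _ (n.+1%:R ^+ (k - 2) * n.+1%:R ^- (k - 1))).
    rewrite ler_wpM2r ?invr_ge0 ?exprn_ge0//.
    rewrite natrX -!powR_mulrn// -powRrM ler_powR ?ler1n//.
    rewrite natrB// natrM; move: kq; rewrite mulrBr mulr1 mulrCA mulrA; lra.
  rewrite (_ : (k - 1 = (k - 2).+1)%N); last by lia.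
  by rewrite exprSr invfM mulrA mulfV ?mul1r// gt_eqF ?exprn_gt0.
- apply/cvgryPge => A; have [t0 t00 ht] := sin_lower_bound R.
  near=> n.
  have An : A <= n.+1%:R by rewrite -natr1 ler_wpDr//; near: n; exact: nbhs_infty_ger.
  have tn : 3 * n.+1%:R^-1 < t0.
    rewrite ltr_pdivrMr// mulrC -ltr_pdivrMr//.
    apply: (@lt_le_trans _ _ n%:R); last by rewrite ler_nat.
    near: n; exact: nbhs_infty_gtr.
  have d0 : 0 < n.+1%:R ^- (k - 1) :> R by rewrite invr_gt0 exprn_gt0.
  have dt : 0 < 3 * (n.+1%:R ^- (k - 1) : R) < t0.
    apply/andP; split; first exact: mulr_gt0.
    by apply: le_lt_trans tn; rewrite ler_pM2l.
  have := ht _ dt; rewrite ler_pM2l// => sd.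
  apply: (le_trans An); rewrite natrX mulnC exprM sqrtr_sqr ger0_norm ?exprn_ge0//.
  apply: (@le_trans _ _ (n.+1%:R ^+ k * n.+1%:R ^- (k - 1))); last first.
    by rewrite ler_pM2l ?exprn_gt0.
  rewrite {1}(_ : k = (k - 1).+1); last by lia.
  by rewrite exprS mulfK// gt_eqF ?exprn_gt0.
Unshelve. all: by end_near.
Qed.

Theorem theorem8p2 (R : realType)
    (w : R -> R) (W : int -> R * R -> R[i])
    (hw : besov_window w) (hW : besov_kernels w W)
    (H : lmodType R[i]) (dot : {dot H for Num.conj})
    (hH : hilbert dot) (hdim : infinite_dim H) :
  (exists (f : nat -> R * R -> R[i]) (A1 A2 B : nat -> {linear H -> H}),
    [/\ forall n : nat, besov W (f n),
        forall n : nat,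
          [/\ self_adjoint dot (A1 n), self_adjoint dot (A2 n) &
              self_adjoint dot (B n)] /\
          [/\ finite_rank (A1 n), finite_rank (A2 n) & finite_rank (B n)],
        forall m n : nat,
          besov_norm W (distr_of (f m)) = besov_norm W (distr_of (f n)),
        (fun n => opnorm dot (fun x => A1 n x - A2 n x)) @ \oo --> 0%E &
        (fun n => opnorm dot (fun x => fun_calc dot (f n) (A1 n) (B n) x
                                     - fun_calc dot (f n) (A2 n) (B n) x))
          @ \oo --> +oo%E]) /\
  (forall p : R, 2 < p ->
   exists (f : nat -> R * R -> R[i]) (A1 A2 B : nat -> {linear H -> H}),
    [/\ forall n : nat, besov W (f n),
        forall n : nat,
          [/\ self_adjoint dot (A1 n), self_adjoint dot (A2 n) &
              self_adjoint dot (B n)] /\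
          [/\ finite_rank (A1 n), finite_rank (A2 n) & finite_rank (B n)],
        forall m n : nat,
          besov_norm W (distr_of (f m)) = besov_norm W (distr_of (f n)),
        (fun n => schatten_norm dot p (fun x => A1 n x - A2 n x))
          @ \oo --> 0%E &
        (fun n => schatten_norm dot p
                    (fun x => fun_calc dot (f n) (A1 n) (B n) x
                            - fun_calc dot (f n) (A2 n) (B n) x))
          @ \oo --> +oo%E]).
Proof.
(* Combines the larger norm where convergence to 0 is claimed with the smaller norm where divergence
   is claimed, so that both assertions follow from it by [opnorm_le_schatten]. *)
have main (p : R) : 2 < p -> exists (f : nat -> R * R -> R[i])
    (A1 A2 B : nat -> {linear H -> H}),
    [/\ forall n : nat, besov W (f n),
        forall n : nat,
          [/\ self_adjoint dot (A1 n), self_adjoint dot (A2 n) &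
              self_adjoint dot (B n)] /\
          [/\ finite_rank (A1 n), finite_rank (A2 n) & finite_rank (B n)],
        forall n : nat, besov_norm W (distr_of (f n)) = 1%E,
        (fun n => schatten_norm dot p (fun x => A1 n x - A2 n x))
          @ \oo --> 0%E &
        (fun n => opnorm dot (fun x => fun_calc dot (f n) (A1 n) (B n) x
                            - fun_calc dot (f n) (A2 n) (B n) x))
          @ \oo --> +oo%E].
  move=> p2.
  have [c c0 hc] := besov_perturbation hw hW dot hdim.
  have [N [d [N0 d0 Nd0 sNd]]] := perturbation_scales p2.
  have /choice[F hF] n : exists F : (R * R -> R[i]) * {linear H -> H} *
      {linear H -> H} * {linear H -> H},
      let: (f, A1, A2, B) := F in
      [/\ besov W f /\ besov_norm W (distr_of f) = 1%E,
        [/\ self_adjoint dot A1, self_adjoint dot A2 & self_adjoint dot B] /\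
        [/\ finite_rank A1, finite_rank A2 & finite_rank B],
        (schatten_norm dot p (fun x => A1 x - A2 x)%R <=
         ((N n)%:R `^ p^-1 * d n)%:E)%E &
        ((c * Num.sqrt (N n)%:R * `|sin (3 * d n)|)%:E <=
         opnorm dot (fun x => fun_calc dot f A1 B x - fun_calc dot f A2 B x)%R)%E].
    have [f [A1 [A2 [B [h1 h2 h3 h4]]]]] := hc (N n) (d n) (N0 n) (d0 n).
    exists (f, A1, A2, B); split => //; apply: h3; lra.
  exists (fun n => (F n).1.1.1), (fun n => (F n).1.1.2),
    (fun n => (F n).1.2), (fun n => (F n).2).
  split.
  - by move=> n; have := hF n; case: (F n) => [[[f A1] A2] B] [[]].
  - by move=> n; have := hF n; case: (F n) => [[[f A1] A2] B] [].
  - by move=> n; have := hF n; case: (F n) => [[[f A1] A2] B] [[]].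
  - have Nd : (fun n => ((N n)%:R `^ p^-1 * d n)%:E) @ \oo --> 0%E.
      by apply: cvg_EFin => //; exact: nearW.
    apply: (squeeze_cvge _ (cvg_cst 0%E) Nd).
    apply: nearW => n; have := hF n; case: (F n) => [[[f A1] A2] B] [_ _ h _].
    by rewrite poweR_ge0.
  - apply/cvgeyPge => A; move/cvgryPge : sNd => /(_ (A / c)).
    apply: filterS => n; rewrite ler_pdivrMr// => An.
    have := hF n; case: (F n) => [[[f A1] A2] B] [_ _ _]; apply: le_trans.
    by rewrite lee_fin (le_trans An)// mulrC mulrA.
split.
  have p3 : 2 < 3 :> R by lra.
  have [f [A1 [A2 [B [h1 h2 h3 h4 h5]]]]] := main 3 p3.
  exists f, A1, A2, B; split; [exact: h1|exact: h2| | |exact: h5].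
    by move=> m n; rewrite !h3.
  apply: (squeeze_cvge _ (cvg_cst 0%E) h4); apply: nearW => n.
  by apply/andP; split; [exact: opnorm_ge0|apply: opnorm_le_schatten; lra].
move=> p p2; have [f [A1 [A2 [B [h1 h2 h3 h4 h5]]]]] := main p p2.
exists f, A1, A2, B; split; [exact: h1|exact: h2| |exact: h4|].
  by move=> m n; rewrite !h3.
apply/cvgeyPge => A; move/cvgeyPge : h5 => /(_ A).
by apply: filterS => n /le_trans; apply; apply: opnorm_le_schatten; lra.
Qed.
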